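(* Let $(X,\mathcal B,\mu)$ be a probability measure space, let $T$ be a weakly mixing invertible measure preserving transformation of $X$ and let $\varphi_1,\dots,\varphi_k:\mathbb Z\to\mathbb Z$ be unbounded generalized linear functions such that $\varphi_j-\varphi_i$ is unbounded for all $i\neq j$. Then for any $f_1,\dots,f_k\in L^\infty(X)$, $$\lim_{N\to\infty}\frac1N\sum_{n=1}^N T^{\varphi_1(n)}f_1\cdots T^{\varphi_k(n)}f_k=\prod_{i=1}^k\int_X f_i\,d\mu$$ in $L^2(X)$. In particular, for any distinct $\alpha_1,\dots,\alpha_k\in\mathbb R\setminus\{0\}$ and any $f_1,\dots,f_k\in L^\infty(X)$, $$\lim_{N\to\infty}\frac1N\sum_{n=1}^N T^{[\alpha_1n]}f_1\cdots T^{[\alpha_kn]}f_k=\prod_{i=1}^k\int_X f_i\,d\mu$$ in $L^2(X)$.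
   Context: For $x\in\mathbb R$, $[x]$ is the integer part of $x$ and $\{x\}=x-[x]$. The set of generalized linear functions is the smallest set of functions $\mathbb R\to\mathbb R$ that contains all functions $x\mapsto ax+b$ ($a,b\in\mathbb R$) and is closed under addition, multiplication by real constants, and the operation $\varphi\mapsto[\varphi]$ (equivalently $\varphi\mapsto\{\varphi\}$). A generalized linear function $\mathbb Z\to\mathbb Z$ is the restriction to $\mathbb Z$ of a generalized linear function that takes integer values on $\mathbb Z$. Write $Tf(x)=f(Tx)$. $T$ is weakly mixing if $T\times T$ is ergodic on $X\times X$. *)

(* Defs.v *)
From HB Require Import structures.
From mathcomp Require Import all_boot all_order all_algebra.
From mathcomp Require Import all_classical all_reals all_analysis.
From mathcomp Require Import complex.

Set Implicit Arguments.
Unset Strict Implicit.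
Unset Printing Implicit Defensive.

Import Order.TTheory GRing.Theory Num.Theory.
Import numFieldNormedType.Exports.

Local Open Scope classical_set_scope.
Local Open Scope ring_scope.

Inductive gen_linear (R : realType) : (R -> R) -> Prop :=
| gen_linear_affine (a b : R) : gen_linear (fun x => a * x + b)
| gen_linear_add (f g : R -> R) :
    gen_linear f -> gen_linear g -> gen_linear (fun x => f x + g x)
| gen_linear_scale (c : R) (f : R -> R) :
    gen_linear f -> gen_linear (fun x => c * f x)
| gen_linear_floor (f : R -> R) :
    gen_linear f -> gen_linear (fun x => (Num.floor (f x))%:~R).

Definition gen_linear_int (R : realType) (phi : int -> int) : Prop :=
  exists2 g : R -> R, gen_linear g & forall n : int, (phi n)%:~R = g n%:~R.

Definition unbounded_int (phi : int -> int) : Prop :=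
  ~ exists M : int, forall n : int, `|phi n| <= M.

Definition measure_preserving d (X : measurableType d) (R : realType)
    (mu : set X -> \bar R) (T : X -> X) : Prop :=
  measurable_fun [set: X] T /\
  forall A : set X, measurable A -> mu (T @^-1` A) = mu A.

(* [Tinv] is kept explicit because negative powers of [T] are needed. *)
Definition invertible_measure_preserving d (X : measurableType d)
    (R : realType) (mu : set X -> \bar R) (T Tinv : X -> X) : Prop :=
  [/\ cancel T Tinv, cancel Tinv T, measurable_fun [set: X] Tinv
    & measure_preserving mu T].

(* [mu] is meant to be a probability measure. *)
Definition ergodic d (Y : measurableType d) (R : realType)
    (mu : set Y -> \bar R) (S : Y -> Y) : Prop :=
  forall A : set Y, measurable A -> S @^-1` A = A ->
    mu A = 0%E \/ mu A = 1%E.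

Definition weakly_mixing d (X : measurableType d) (R : realType)
    (P : probability X R) (T : X -> X) : Prop :=
  ergodic (P \x P)%E
    (fun z : X * X => (T z.1, T z.2)).

(* T^m for m in Z; [Negz n] is -(n + 1). *)
Definition iterz (X : Type) (T Tinv : X -> X) (m : int) : X -> X :=
  match m with
  | Posz n => iter n T
  | Negz n => iter n.+1 Tinv
  end.

(* [Normc.normc] is the modulus of a complex number as an element of [R]. *)
Definition Linfty_complex d (X : measurableType d) (R : realType)
    (mu : {measure set X -> \bar R}) (f : X -> R[i]) : Prop :=
  [/\ measurable_fun [set: X] (fun x => complex.Re (f x)),
      measurable_fun [set: X] (fun x => complex.Im (f x))
    & (Lnorm mu +oo (fun x => (Normc.normc (f x))%:E) < +oo)%E].

Definition cvg_L2_complex d (X : measurableType d) (R : realType)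
    (mu : {measure set X -> \bar R}) (F : nat -> X -> R[i]) (G : X -> R[i]) :
    Prop :=
  Lnorm mu 2%:E (fun x => (Normc.normc (F N x - G x))%:E)
    @[N --> \oo] --> 0%E.

Definition integral_complex d (X : measurableType d) (R : realType)
    (mu : {measure set X -> \bar R}) (f : X -> R[i]) : R[i] :=
  Complex (Rintegral mu [set: X] (fun x => complex.Re (f x)))
          (Rintegral mu [set: X] (fun x => complex.Im (f x))).

Definition ergodic_average (X : Type) (R : realType) (T Tinv : X -> X)
    (k : nat) (phi : 'I_k -> int -> int) (f : 'I_k -> X -> R[i])
    (N : nat) (x : X) : R[i] :=
  N%:R^-1 *
  \sum_(1 <= n < N.+1) \prod_(i < k) f i (iterz T Tinv (phi i n%:Z) x).

(* Main.v *)
Require Import Defs.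
From HB Require Import structures.
From mathcomp Require Import all_boot all_order all_algebra.
From mathcomp Require Import all_classical all_reals all_analysis.
From mathcomp Require Import measurable_realfun ess_sup_inf.
From mathcomp Require Import complex.
From mathcomp Require Import ring lra zify.

Set Implicit Arguments.
Unset Strict Implicit.
Unset Printing Implicit Defensive.

Import Order.TTheory GRing.Theory Num.Theory.
Import numFieldNormedType.Exports.

Local Open Scope classical_set_scope.
Local Open Scope ring_scope.

(** By induction on its construction, a generalized linear function stays within
    a bounded distance of a linear function [n => a n]
    ([gen_linear_near_linear]); unboundedness of the [phi i] and of their
    differences says that the slopes are nonzero and pairwise distinct. The
    argument is run for arbitrary integer sequences [phi i] near lines with such
    slopes, and proves more than convergence of the plain averages: for every
    bounded sequence of weights [w], the averages of
      [w n * (prod_i f_i (T^(phi_i n) x) - prod_i int f_i)]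
    tend to zero in L^1 ([jointly_mixing_of_slopes]). Weights are what makes
    an induction on the number of factors possible.

    Splitting off the mean of the first factor leaves a shorter product, covered
    by the induction hypothesis, and a product whose first factor has mean zero
    ([joint_head_mean0]). For the latter, van der Corput's lemma
    ([van_der_corput]) asks for the correlations of the products at times [n + h]
    and [n + h'], averaged over [n]. Since [phi_i (n + h) - phi_i n] takes
    finitely many values for fixed [h], such a correlation is
      [int F_0 n * prod_(i > 0) F_i n (T^(phi_i n - phi_0 n) x)],
    where the measure has been translated by [T^(phi_0 n)] and each [F_i n] runs
    through finitely many functions. The exponents [phi_i - phi_0] have nonzero
    distinct slopes and there is one factor fewer, so by the induction hypothesis
    the product may be replaced by the product of the means of the [F_i n]; the
    weights serve to sort the times [n] according to the value of [F_0 n]. The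
    mean of [F_0 n] is a correlation [int f (T^m x) * g x] of mean-zero functions
    with [m] near [a_0 (h - h')].

    Weak mixing makes those correlations small on average over [m]
    ([weakly_mixing_correlation]): their squares are correlations for [T x T],
    whose ergodicity enters through the pointwise ergodic theorem for bounded
    functions, proved here from Garsia's maximal inequality ([maximal_ergodic]).
    As a line of nonzero slope passes near each integer boundedly often, they are
    also small on average over [h] and [h'] ([near_line_double_avg]).

    Complex functions are reduced to real ones by expanding products into real
    and imaginary parts, and essentially bounded functions to bounded ones by
    truncation; for uniformly bounded functions, convergence to zero in L^1 and
    in L^2 agree. *)

(** * Bounded measurable functions and their means *)

Definition bounded_measurable d (Y : measurableType d) (R : realType)
    (f : Y -> R) : Prop :=
  measurable_fun setT f /\ exists M : R, forall y, `|f y| <= M.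

Section BoundedMeasurable.
Context d (Y : measurableType d) (R : realType).
Implicit Types f g : Y -> R.

Lemma bounded_measurable_cst (c : R) : bounded_measurable (fun _ : Y => c).
Proof. by split; [exact: measurable_cst | exists `|c|]. Qed.

Lemma bounded_measurableD f g : bounded_measurable f -> bounded_measurable g ->
  bounded_measurable (fun y => f y + g y).
Proof.
move=> [mf [M hM]] [mg [L hL]]; split; first exact: measurable_funD.
by exists (M + L) => y; rewrite (le_trans (ler_normD _ _))// lerD.
Qed.

Lemma bounded_measurableM f g : bounded_measurable f -> bounded_measurable g ->
  bounded_measurable (fun y => f y * g y).
Proof.
move=> [mf [M hM]] [mg [L hL]]; split; first exact: measurable_funM.
by exists (M * L) => y; rewrite normrM ler_pM.
Qed.

Lemma bounded_measurableZ (c : R) f : bounded_measurable f ->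
  bounded_measurable (fun y => c * f y).
Proof. by apply: bounded_measurableM; exact: bounded_measurable_cst. Qed.

Lemma bounded_measurableB f g : bounded_measurable f -> bounded_measurable g ->
  bounded_measurable (fun y => f y - g y).
Proof.
move=> [mf [M hM]] [mg [L hL]]; split; first exact: measurable_funB.
by exists (M + L) => y; rewrite (le_trans (ler_normB _ _))// lerD.
Qed.

Lemma bounded_measurable_norm f : bounded_measurable f ->
  bounded_measurable (fun y => `|f y|).
Proof.
move=> [mf [M hM]]; split; last by exists M => y; rewrite normr_id.
exact: measurableT_comp.
Qed.

Lemma bounded_measurable_sqr f : bounded_measurable f ->
  bounded_measurable (fun y => f y ^+ 2).
Proof. by move=> bf; exact: bounded_measurableM. Qed.

Lemma bounded_measurable_sum I (s : seq I) (Q : pred I) (F : I -> Y -> R) :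
  (forall i, bounded_measurable (F i)) ->
  bounded_measurable (fun y => \sum_(i <- s | Q i) F i y).
Proof.
move=> bF; elim: s => [|i s ih].
  under eq_fun do rewrite big_nil; exact: bounded_measurable_cst.
under eq_fun do rewrite big_cons; case: (Q i) => //.
exact: bounded_measurableD.
Qed.

Lemma bounded_measurable_prod I (s : seq I) (F : I -> Y -> R) :
  (forall i, bounded_measurable (F i)) ->
  bounded_measurable (fun y => \prod_(i <- s) F i y).
Proof.
move=> bF; elim: s => [|i s ih].
  under eq_fun do rewrite big_nil; exact: bounded_measurable_cst.
under eq_fun do rewrite big_cons.
exact: bounded_measurableM.
Qed.

End BoundedMeasurable.

Lemma bounded_measurable_comp d d' (Y : measurableType d)
    (Z : measurableType d') (R : realType) (f : Z -> R) (S : Y -> Z) :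
  measurable_fun setT S -> bounded_measurable f ->
  bounded_measurable (fun y => f (S y)).
Proof.
move=> mS [mf [M hM]]; split; last by exists M => y; exact: hM.
exact: measurableT_comp.
Qed.

Section Mean.
Context d (Y : measurableType d) (R : realType) (Q : probability Y R).
Implicit Types f g : Y -> R.

Lemma bounded_measurable_integrable f : bounded_measurable f ->
  Q.-integrable setT (EFin \o f).
Proof.
move=> [mf [M hM]]; apply: measurable_bounded_integrable => //.
  by rewrite ltey_eq fin_num_measure.
exists M; split => [|L ML]; first exact: num_real.
move=> y _ /=.
by rewrite (le_trans (hM y))// ltW.
Qed.

Let int := bounded_measurable_integrable.

Lemma mean_cst (c : R) : \int[Q]_y c = c.
Proof.
rewrite Rintegral_cst// -[RHS]mulr1; congr (c * _).
exact: (congr1 fine (probability_setT Q)).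
Qed.

Lemma meanD f g : bounded_measurable f -> bounded_measurable g ->
  \int[Q]_y (f y + g y) = \int[Q]_y f y + \int[Q]_y g y.
Proof. by move=> bf bg; rewrite RintegralD//; exact: int. Qed.

Lemma meanB f g : bounded_measurable f -> bounded_measurable g ->
  \int[Q]_y (f y - g y) = \int[Q]_y f y - \int[Q]_y g y.
Proof. by move=> bf bg; rewrite RintegralB//; exact: int. Qed.

Lemma meanZ (c : R) f : bounded_measurable f ->
  \int[Q]_y (c * f y) = c * \int[Q]_y f y.
Proof. by move=> bf; rewrite RintegralZl//; exact: int. Qed.

Lemma mean_sum I (s : seq I) (F : I -> Y -> R) :
  (forall i, bounded_measurable (F i)) ->
  \int[Q]_y (\sum_(i <- s) F i y) = \sum_(i <- s) \int[Q]_y F i y.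
Proof.
move=> bF; elim: s => [|i s ih].
  by under eq_Rintegral do rewrite big_nil; rewrite big_nil mean_cst.
under eq_Rintegral do rewrite big_cons.
rewrite big_cons meanD ?ih//; exact: bounded_measurable_sum.
Qed.

Lemma le_mean f g : bounded_measurable f -> bounded_measurable g ->
  (forall y, f y <= g y) -> \int[Q]_y f y <= \int[Q]_y g y.
Proof. by move=> bf bg fg; apply: le_Rintegral => //; exact: int. Qed.

Lemma le_norm_mean f : bounded_measurable f ->
  `|\int[Q]_y f y| <= \int[Q]_y `|f y|.
Proof. by move=> bf; apply: le_normr_Rintegral => //; exact: int. Qed.

Lemma norm_mean_le f (M : R) : bounded_measurable f ->
  (forall y, `|f y| <= M) -> `|\int[Q]_y f y| <= M.
Proof.
move=> bf fM; rewrite (le_trans (le_norm_mean bf))// -[leRHS]mean_cst.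
apply: le_mean => //; [exact: bounded_measurable_norm|].
exact: bounded_measurable_cst.
Qed.

(** Jensen's inequality for the square: the variance is nonnegative. *)
Lemma sqr_mean_le f : bounded_measurable f ->
  (\int[Q]_y f y) ^+ 2 <= \int[Q]_y (f y ^+ 2).
Proof.
move=> bf; set m := \int[Q]_y f y.
have b2 := bounded_measurable_sqr bf.
have bmf := bounded_measurableZ (2 * m) bf.
have : 0 <= \int[Q]_y (f y ^+ 2 - 2 * m * f y + m ^+ 2).
  apply: Rintegral_ge0 => y _; rewrite (_ : _ + _ = (f y - m) ^+ 2) ?sqr_ge0//.
  by rewrite sqrrB; ring.
rewrite meanD; [|exact: bounded_measurableB|exact: bounded_measurable_cst].
rewrite meanB// meanZ// mean_cst -/m.
move=> h; rewrite -subr_ge0; apply: (le_trans h).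
by rewrite le_eqVlt; apply/orP; left; apply/eqP; ring.
Qed.

(** Dominated convergence with a constant bound, integrable since the measure
    is finite. *)
Lemma bounded_convergence (F : nat -> Y -> R) (B : R) :
  (forall n, measurable_fun setT (F n)) ->
  (forall n y, `|F n y| <= B) ->
  {ae Q, forall y, F n y @[n --> \oo] --> (0 : R)} ->
  \int[Q]_y `|F n y| @[n --> \oo] --> (0 : R).
Proof.
move=> mF FB F0.
have /= := @dominated_convergence _ _ _ Q setT measurableT
  (fun n => EFin \o F n) (cst 0%E) (cst B%:E) _ _ _ _ _.
case.
- by move=> n; exact/measurable_EFinP.
- exact: measurable_cst.
- by apply: filterS F0 => y Fy _; apply: cvg_EFin => //; exact: nearW.
- by apply: int; exact: bounded_measurable_cst.
- by apply: aeW => y n _ /=; rewrite lee_fin.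
move=> _ h _.
apply: (@cvg_trans _
  ((fine (\int[Q]_y `|(F n y)%:E - 0|)%E) @[n --> \oo])).
  apply: near_eq_cvg; apply: nearW => n; congr fine.
  by apply: eq_integral => y _; rewrite sube0 abse_EFin.
exact: (fine_cvg h).
Qed.

Lemma mean_measure_preserving (S : Y -> Y) f : measure_preserving Q S ->
  bounded_measurable f -> \int[Q]_y f (S y) = \int[Q]_y f y.
Proof.
move=> [mS hS] bf; rewrite /Rintegral; congr fine.
have [mf _] := bf.
have := @integral_pushforward _ _ _ _ _ _ mS Q setT (EFin \o f).
rewrite preimage_setT => <- //.
- by apply: eq_measure_integral => A mA _; exact: hS.
- exact/measurable_EFinP.
- exact: (int (bounded_measurable_comp mS bf)).
Qed.

End Mean.

(** * The mean ergodic theorem for bounded functions *)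

Lemma near_le_natr (R : realType) (c e : R) : 0 < e ->
  \forall N \near \oo, c <= e * N%:R.
Proof.
move=> e0; near=> N; rewrite mulrC -ler_pdivrMr//.
near: N; exact: nbhs_infty_ger.
Unshelve. all: by end_near. Qed.

Lemma cvg0_near (R : realType) (u : nat -> R) :
  u n @[n --> \oo] --> (0 : R) <->
  forall e : R, 0 < e -> \forall n \near \oo, `|u n| <= e.
Proof. by split => [/cvgr0Pnorm_le|h]; last apply/cvgr0Pnorm_le. Qed.

Lemma cvg0_squeeze (R : realType) (u v : nat -> R) :
  (\forall n \near \oo, `|u n| <= v n) ->
  v n @[n --> \oo] --> (0 : R) -> u n @[n --> \oo] --> (0 : R).
Proof.
move=> uv /cvg0_near v0; apply/cvg0_near => e e0.
apply: filterS2 uv (v0 e e0) => n uvn; apply: le_trans.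
by rewrite (le_trans uvn)// ler_norm.
Qed.

Lemma cvg0D (R : realType) (u v : nat -> R) :
  u n @[n --> \oo] --> (0 : R) -> v n @[n --> \oo] --> (0 : R) ->
  u n + v n @[n --> \oo] --> (0 : R).
Proof.
move=> /cvg0_near u0 /cvg0_near v0; apply/cvg0_near => e e0.
have e2 : 0 < e / 2 by rewrite divr_gt0.
apply: filterS2 (u0 _ e2) (v0 _ e2) => n h1 h2.
rewrite (le_trans (ler_normD _ _))//; lra.
Qed.

Lemma cvg0_sum (R : realType) I (s : seq I) (u : I -> nat -> R) :
  (forall i, u i n @[n --> \oo] --> (0 : R)) ->
  \sum_(i <- s) u i n @[n --> \oo] --> (0 : R).
Proof.
move=> u0; elim: s => [|i s ih].
  apply: (@cvg0_squeeze _ _ (fun=> 0)); last exact: cvg_cst.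
  by apply: nearW => n; rewrite big_nil normr0.
rewrite (_ : (fun n => _) = (fun n => u i n + \sum_(j <- s) u j n)); last first.
  by apply/funext => n; rewrite big_cons.
exact: cvg0D.
Qed.

Lemma cvg0Z (R : realType) (c : R) (u : nat -> R) :
  u n @[n --> \oo] --> (0 : R) -> c * u n @[n --> \oo] --> (0 : R).
Proof. by move=> u0; rewrite -(mulr0 c); apply: cvgM => //; exact: cvg_cst. Qed.

Section Ergodic.
Context d (Y : measurableType d) (R : realType) (Q : probability Y R).
Variables (S : Y -> Y) (mpS : measure_preserving Q S).

Definition orbit_sum (F : Y -> R) (N : nat) (y : Y) : R :=
  \sum_(n < N) F (iter n S y).

Lemma orbit_sumS F N y : orbit_sum F N.+1 y = F y + orbit_sum F N (S y).
Proof.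
rewrite /orbit_sum big_ord_recl /=; congr (_ + _).
by apply: eq_bigr => i _; rewrite -iterSr.
Qed.

Lemma measurable_iter n : measurable_fun setT (iter n S).
Proof.
elim: n => [|n ih]; first exact: measurable_id.
by apply: (measurableT_comp mpS.1).
Qed.

Lemma bounded_measurable_orbit_sum F N : bounded_measurable F ->
  bounded_measurable (orbit_sum F N).
Proof.
move=> bF; apply: bounded_measurable_sum => i.
exact: (bounded_measurable_comp (measurable_iter i)).
Qed.

(** The maximum of the orbit sums of length at most [N]: a nonempty orbit sum
    from [y] is [F y] plus an orbit sum from [S y]. *)
Fixpoint max_orbit_sum (F : Y -> R) (N : nat) (y : Y) : R :=
  if N is N'.+1 then Num.max 0 (F y + max_orbit_sum F N' (S y)) else 0.

Lemma max_orbit_sum_ge0 F N y : 0 <= max_orbit_sum F N y.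
Proof. by case: N => //= N; rewrite le_max lexx. Qed.

Lemma max_orbit_sum_le F N y : max_orbit_sum F N y <= max_orbit_sum F N.+1 y.
Proof.
elim: N y => [|N ih] y; first exact: max_orbit_sum_ge0.
rewrite [leLHS]/= [leRHS]/= ge_max le_max lexx /= le_max; apply/orP; right.
by rewrite lerD2l; exact: ih.
Qed.

Lemma orbit_sum_le_max F N y : orbit_sum F N y <= max_orbit_sum F N y.
Proof.
elim: N y => [|N ih] y; first by rewrite /orbit_sum big_ord0.
by rewrite orbit_sumS /= le_max lerD2l ih orbT.
Qed.

Lemma bounded_measurable_max_orbit_sum F N : bounded_measurable F ->
  bounded_measurable (max_orbit_sum F N).
Proof.
move=> bF; elim: N => [|N ih] /=; first exact: bounded_measurable_cst.
have [mg [M hM]] := bounded_measurableD bF (bounded_measurable_comp mpS.1 ih).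
split; first by apply: measurable_maxr => //; exact: measurable_cst.
exists M => y; rewrite ger0_norm ?le_max ?lexx// ge_max.
by rewrite (le_trans _ (hM y))//= (le_trans (ler_norm _)).
Qed.

(** The maximal ergodic theorem, by Garsia's argument: wherever the maximum of
    the orbit sums is positive, [F] dominates the coboundary of that maximum;
    elsewhere the coboundary is at most zero; and a coboundary has mean zero. *)
Lemma maximal_ergodic F : bounded_measurable F ->
  {ae Q, forall y, exists N, 0 < orbit_sum F N y} -> 0 <= \int[Q]_y F y.
Proof.
move=> bF posF; have [mF [M hM]] := bF.
pose G N y : R := if 0 < max_orbit_sum F N y then F y else 0.
have bG N : bounded_measurable (G N).
  split; last first.
    exists M => y; rewrite /G; case: ifP => // _.
    by rewrite normr0 (le_trans _ (hM y)).
  apply: measurable_fun_ifT => //.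
    apply: measurable_fun_ltr => //.
    by have [] := bounded_measurable_max_orbit_sum N bF.
have meanG N : 0 <= \int[Q]_y G N.+1 y.
  have bm := bounded_measurable_max_orbit_sum N.+1 bF.
  have bmS := bounded_measurable_comp mpS.1 bm.
  have <- : \int[Q]_y (max_orbit_sum F N.+1 y - max_orbit_sum F N.+1 (S y)) = 0.
    by rewrite meanB// (mean_measure_preserving mpS bm) subrr.
  apply: le_mean => //; first exact: bounded_measurableB.
  move=> y; rewrite /G; case: ltP => [m0|m0].
    rewrite lerBlDr (le_trans _ (_ : F y + max_orbit_sum F N (S y) <= _))//.
      move: m0; rewrite /= lt_max ltxx /= => m0.
      by rewrite ge_max lexx andbT ltW.
    by rewrite lerD2l max_orbit_sum_le.
  by rewrite subr_le0 (le_trans m0)// max_orbit_sum_ge0.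
have : \int[Q]_y `|G N.+1 y - F y| @[N --> \oo] --> (0 : R).
  apply: (@bounded_convergence _ _ _ _ _ (M + M)).
  - by move=> N; have [] := bounded_measurableB (bG N.+1) bF.
  - move=> N y; rewrite (le_trans (ler_normB _ _))// lerD// /G.
    by case: ifP => // _; rewrite normr0 (le_trans _ (hM y)).
  - apply: filterS posF => y [N0 hN0].
    have posM N : (N0 <= N)%N -> 0 < max_orbit_sum F N y.
      move=> N0N; rewrite (lt_le_trans hN0)// (le_trans (orbit_sum_le_max _ _ _))//.
      rewrite -(subnK N0N); elim: (N - N0)%N => // k ih.
      by rewrite addSn (le_trans ih)// max_orbit_sum_le.
    apply: (@cvg_trans _ (nbhs (0 : R))) => //.
    apply: cvg_near_cst; near=> N; rewrite /G posM ?subrr//.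
    by apply: leqW; near: N; exact: nbhs_infty_ge.
move=> cv; rewrite leNgt; apply/negP => neg.
have e0 : 0 < - \int[Q]_y F y by rewrite oppr_gt0.
have /cvgrPdist_lt /(_ _ e0) [N _ /(_ N (leqnn N))] := cv.
rewrite sub0r normrN ltNge => /negP; apply.
rewrite ger0_norm ?Rintegral_ge0//.
apply: le_trans (le_norm_mean _ (bounded_measurableB (bG N.+1) bF)).
rewrite meanB//; apply: le_trans (ler_norm _).
by have := meanG N; lra.
Unshelve. all: by end_near. Qed.

Hypothesis ergS : ergodic Q S.

(** Dropping the first term of the orbit sums does not affect whether they are
    unbounded above, so the points where they are form a strictly invariant set;
    were it of full measure, the maximal theorem would make the mean of [F]
    nonnegative. *)
Lemma orbit_sum_bounded_above F : bounded_measurable F -> \int[Q]_y F y < 0 ->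
  {ae Q, forall y, exists K : nat, forall N, orbit_sum F N y <= K%:R}.
Proof.
move=> bF negF; have [mF [M hM]] := bF.
pose E := \bigcap_(K : nat) \bigcup_(N : nat) [set y | K%:R < orbit_sum F N y].
have mE : measurable E.
  apply: bigcapT_measurable => K; apply: bigcupT_measurable => N.
  rewrite -[X in measurable X]setTI.
  apply: measurable_fun_ltr => //.
  by have [] := bounded_measurable_orbit_sum N bF.
have invE : S @^-1` E = E.
  apply/seteqP; split => y Ey K _.
    have [N _ /= h] := Ey (K + Num.truncn `|F y|).+1 I.
    exists N.+1 => //=; rewrite orbit_sumS.
    have := truncnS_gt `|F y|; have := ler_norm (- F y); rewrite normrN.
    move: h; rewrite -addnS natrD; lra.
  have [[|N] _ /= h] := Ey (K + Num.truncn `|F y|).+1 I.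
    by move: h; rewrite /orbit_sum big_ord0 ltNge ler0n.
  exists N => //=; move: h; rewrite orbit_sumS -addnS natrD.
  have := truncnS_gt `|F y|; have := ler_norm (F y); lra.
case: (ergS mE invE) => QE.
  exists E; split => // y /= h K _; apply: contrapT => hK; apply: h; exists K => N.
  by rewrite leNgt; apply/negP => hN; apply: hK; exists N.
suff : 0 <= \int[Q]_y F y by rewrite leNgt negF.
apply: maximal_ergodic => //; exists (~` E); split.
- exact: measurableC.
- by rewrite probability_setC// QE subee.
- move=> y /= h Ey; apply: h; have [N _ hN] := Ey 0%N I.
  by exists N.
Qed.

(** Subtracting a small positive constant from [F] or from [- F] gives a negative
    mean, hence orbit sums bounded above: so those of [F] are [o(N)] almost
    everywhere. *)
Lemma mean_ergodic F : bounded_measurable F -> \int[Q]_y F y = 0 ->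
  \int[Q]_y `|N%:R^-1 * orbit_sum F N y| @[N --> \oo] --> (0 : R).
Proof.
move=> bF F0; have [mF [M hM]] := bF.
have sumB (s : R) (e : R) N y : orbit_sum (fun y => s * F y - e) N y =
    s * orbit_sum F N y - e * N%:R.
  by rewrite /orbit_sum sumrB mulr_sumr sumr_const card_ord mulr_natr.
have bd (s : R) (m : nat) : {ae Q, forall y, exists K : nat, forall N,
    s * orbit_sum F N y <= K%:R + m.+1%:R^-1 * N%:R}.
  have bG : bounded_measurable (fun y => s * F y - m.+1%:R^-1).
    apply: bounded_measurableB; last exact: bounded_measurable_cst.
    exact: bounded_measurableZ.
  have : \int[Q]_y (s * F y - m.+1%:R^-1) < 0.
    rewrite meanB ?meanZ ?mean_cst// ?F0 ?mulr0 ?sub0r ?oppr_lt0 ?invr_gt0//.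
      exact: bounded_measurableZ.
    exact: bounded_measurable_cst.
  move=> /(orbit_sum_bounded_above bG); apply: filterS => y [K hK].
  by exists K => N; have := hK N; rewrite sumB lerBlDr.
apply: (@bounded_convergence _ _ _ _ _ M).
- move=> N; have bO := bounded_measurable_orbit_sum N bF.
  by have [] := bounded_measurableZ N%:R^-1 bO.
- move=> N y; have [->|N0] := posnP N.
    by rewrite /orbit_sum big_ord0 mulr0 normr0 (le_trans _ (hM y)).
  rewrite normrM ger0_norm ?invr_ge0// ler_pdivrMl ?ltr0n//.
  rewrite mulr_natl -[in leRHS](card_ord N) -sumr_const.
  by rewrite (le_trans (ler_norm_sum _ _ _))// ler_sum.
- have := @ae_foralln _ _ _ Q _ (bd 1); have := @ae_foralln _ _ _ Q _ (bd (-1)).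
  apply: filterS2 => y lo up; apply/cvg0_near => e e0.
  pose m := Num.truncn (e^-1 * 2).
  have me : m.+1%:R^-1 <= e / 2.
    rewrite -[e / 2]invrK lef_pV2 ?posrE ?invr_gt0 ?divr_gt0//.
    by rewrite invf_div mulrC ltW// truncnS_gt.
  have [K hK] := lo m; have [L hL] := up m.
  near=> N.
  have N0 : (0 < N)%N by near: N; exact: nbhs_infty_gt.
  rewrite normrM ger0_norm ?invr_ge0// ler_pdivrMl ?ltr0n//.
  have hKN : K%:R <= e / 2 * N%:R by near: N; apply: near_le_natr; exact: divr_gt0.
  have hLN : L%:R <= e / 2 * N%:R by near: N; apply: near_le_natr; exact: divr_gt0.
  have : m.+1%:R^-1 * N%:R <= e / 2 * N%:R by rewrite ler_wpM2r.
  move: (hK N) (hL N); rewrite mul1r mulN1r.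
  move: (m.+1%:R^-1 * N%:R) (orbit_sum F N y) => q s h1 h2 h3.
  rewrite ler_norml; apply/andP; split; lra.
Unshelve. all: by end_near. Qed.

End Ergodic.

(** * Decay of correlations on average *)

Lemma sqr_sum_le (R : realFieldType) (N : nat) (a : nat -> R) :
  (\sum_(n < N) a n) ^+ 2 <= N%:R * \sum_(n < N) a n ^+ 2.
Proof.
have [->|N0] := posnP N; first by rewrite !big_ord0 expr0n mul0r.
have Nr : (N%:R : R) != 0 by rewrite pnatr_eq0 -lt0n.
set s := \sum_(n < N) a n; set q := \sum_(n < N) _.
pose m := N%:R^-1 * s.
have : 0 <= \sum_(n < N) (a n - m) ^+ 2.
  by apply: sumr_ge0 => n _; exact: sqr_ge0.
have -> : \sum_(n < N) (a n - m) ^+ 2 = N%:R^-1 * (N%:R * q - s ^+ 2).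
  transitivity (\sum_(n < N) (a n ^+ 2 - (2 * m) * a n + m ^+ 2)).
    by apply: eq_bigr => n _; ring.
  rewrite big_split sumrB /= sumr_const card_ord -mulr_sumr -/s -/q -mulr_natr.
  by rewrite /m; field.
by rewrite pmulr_rge0 ?invr_gt0 ?ltr0n// subr_ge0.
Qed.

Lemma sqr_avg_le (R : realFieldType) (N : nat) (a : nat -> R) :
  (N%:R^-1 * \sum_(n < N) a n) ^+ 2 <= N%:R^-1 * \sum_(n < N) a n ^+ 2.
Proof.
have [->|N0] := posnP N; first by rewrite !big_ord0 !mulr0 expr0n.
rewrite exprMn expr2 -mulrA ler_wpM2l ?invr_ge0//.
by rewrite ler_pdivrMl ?ltr0n// sqr_sum_le.
Qed.

Lemma norm_le_of_sqr (R : realDomainType) (x e : R) :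
  0 <= e -> x ^+ 2 <= e ^+ 2 -> `|x| <= e.
Proof.
by move=> e0 h; rewrite -(@ler_pXn2r _ 2)// ?nnegrE// real_normK ?num_real.
Qed.

Section WeakMixing.
Context d (X : measurableType d) (R : realType) (P : probability X R).
Variables (T : X -> X) (mpT : measure_preserving P T).

Let Q : probability (X * X)%type R := (P \x P)%E.
Let S (z : X * X) := (T z.1, T z.2).

(** By Cavalieri: the section of the preimage of [A] at [x] is the preimage of
    the section of [A] at [T x]. *)
Lemma measure_preserving_prod : measure_preserving Q S.
Proof.
have [mT hT] := mpT.
have mS : measurable_fun setT S.
  by apply: measurable_fun_pair; apply: measurableT_comp => //.
split=> // A mA; have mSA : measurable (S @^-1` A).
  by rewrite -[X in measurable X]setTI; exact: mS.
rewrite /Q /= /product_measure1 /=.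
transitivity (\int[P]_x (P \o xsection A) (T x))%E.
  apply: eq_integral => x _ /=.
  rewrite -[RHS]hT; last exact: measurable_xsection.
  by congr (P _); apply/seteqP; split => y; rewrite /xsection /= !inE.
have := @ge0_integral_pushforward _ _ _ _ _ _ mT P setT (P \o xsection A).
rewrite preimage_setT => h; rewrite -h//.
- by apply: eq_measure_integral => B mB _; exact: hT.
- exact: measurable_fun_xsection.
Qed.

Lemma mean_prod (f g : X -> R) : bounded_measurable f -> bounded_measurable g ->
  \int[Q]_z (f z.1 * g z.2) = \int[P]_x f x * \int[P]_x g x.
Proof.
move=> bf bg.
have b : bounded_measurable (fun z : X * X => f z.1 * g z.2).
  by apply: bounded_measurableM; apply: bounded_measurable_comp.
rewrite {1}/Rintegral -(integral12_prod_meas1 (bounded_measurable_integrable Q b)).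
transitivity (fine (\int[P]_x (f x * \int[P]_y g y)%:E)%E).
  congr fine; apply: eq_integral => x _; rewrite /fubini_F /=.
  rewrite -(meanZ P (f x) bg) /Rintegral fineK//.
  apply: integrable_fin_num => //.
  exact: (bounded_measurable_integrable P (bounded_measurableZ (f x) bg)).
rewrite -/(Rintegral P setT _); under eq_Rintegral do rewrite mulrC.
by rewrite meanZ// mulrC.
Qed.

Hypothesis wmT : weakly_mixing P T.

(** The square of a correlation is a correlation for [T x T], where the ergodic
    theorem applies to the mean-zero function [f x * f y]. *)
Lemma weakly_mixing_correlation (f g : X -> R) :
  bounded_measurable f -> bounded_measurable g -> \int[P]_x f x = 0 ->
  N%:R^-1 * \sum_(n < N) `|\int[P]_x (f (iter n T x) * g x)|
    @[N --> \oo] --> (0 : R).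
Proof.
move=> bf bg f0.
pose F (z : X * X) := f z.1 * f z.2; pose G (z : X * X) := g z.1 * g z.2.
have bF : bounded_measurable F.
  by apply: bounded_measurableM; apply: bounded_measurable_comp.
have bG : bounded_measurable G.
  by apply: bounded_measurableM; apply: bounded_measurable_comp.
have F0 : \int[Q]_z F z = 0 by rewrite mean_prod// f0 mul0r.
have iterS n z : iter n S z = (iter n T z.1, iter n T z.2).
  by elim: n => [|n ih]; [case: z | rewrite /= ih].
have bfT n : bounded_measurable (fun x => f (iter n T x)).
  exact: (bounded_measurable_comp (measurable_iter mpT n) bf).
have bFS n : bounded_measurable (fun z => F (iter n S z)).
  exact: (bounded_measurable_comp (measurable_iter measure_preserving_prod n) bF).
have corE n : `|\int[P]_x (f (iter n T x) * g x)| ^+ 2 =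
    \int[Q]_z (F (iter n S z) * G z).
  rewrite real_normK ?num_real// expr2.
  rewrite -[RHS]/(\int[Q]_z _) -mean_prod; try exact: bounded_measurableM.
  by apply: eq_Rintegral => z _; rewrite /F /G iterS /=; ring.
have [_ [M hM]] := bG.
have erg := mean_ergodic measure_preserving_prod wmT bF F0.
apply/cvg0_near => e e0.
have M0 : 0 <= M by rewrite (le_trans _ (hM (point, point))).
have e20 : 0 < e ^+ 2 / (M + 1) by rewrite divr_gt0 ?exprn_gt0// ltr_wpDl.
have /cvg0_near /(_ _ e20) := erg; apply: filterS => N hN.
apply: norm_le_of_sqr; first exact: ltW.
apply: (le_trans (sqr_avg_le N (fun n => `|\int[P]_x (f (iter n T x) * g x)|))).
under eq_bigr do rewrite corE.
rewrite -(mean_sum _ _ (fun n : 'I_N => bounded_measurableM (bFS n) bG)).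
under eq_Rintegral do rewrite -mulr_suml -/(orbit_sum S F N _).
have bO := bounded_measurable_orbit_sum measure_preserving_prod N bF.
have bN := bounded_measurable_norm (bounded_measurableZ N%:R^-1 bO).
rewrite -meanZ; last exact: bounded_measurableM.
apply: (@le_trans _ _ (\int[Q]_z (M * `|N%:R^-1 * orbit_sum S F N z|))).
  apply: le_mean.
  - by apply/bounded_measurableZ/bounded_measurableM.
  - exact: bounded_measurableZ.
  - move=> z; rewrite mulrA mulrC (le_trans (ler_norm _))// normrM.
    by rewrite ler_wpM2r.
rewrite meanZ//; move: hN; rewrite ger0_norm ?Rintegral_ge0//.
rewrite ler_pdivlMr; last lra.
set q := \int[Q]_z _; have q0 : 0 <= q by apply: Rintegral_ge0.
by move=> h; apply: le_trans h; rewrite mulrC ler_wpM2l//; lra.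
Qed.

End WeakMixing.

(** * Averages and van der Corput's inequality *)

Definition avg (R : realFieldType) (N : nat) (a : nat -> R) : R :=
  N%:R^-1 * \sum_(n < N) a n.

Section Avg.
Context (R : realFieldType).
Implicit Types (a b : nat -> R) (N : nat).

Lemma eq_avg N a b : a =1 b -> avg N a = avg N b.
Proof. by move=> ab; rewrite /avg; congr (_ * _); apply: eq_bigr => i _. Qed.

Lemma avgD N a b : avg N (fun n => a n + b n) = avg N a + avg N b.
Proof. by rewrite /avg big_split mulrDr. Qed.

Lemma avgZ N (c : R) a : avg N (fun n => c * a n) = c * avg N a.
Proof. by rewrite /avg -mulr_sumr mulrCA. Qed.

Lemma avg_sum N I (s : seq I) (a : I -> nat -> R) :
  avg N (fun n => \sum_(i <- s) a i n) = \sum_(i <- s) avg N (a i).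
Proof. by rewrite /avg exchange_big mulr_sumr. Qed.

Lemma exchange_avg N M (a : nat -> nat -> R) :
  avg N (fun n => avg M (a n)) = avg M (fun m => avg N (a^~ m)).
Proof.
by rewrite /avg -!mulr_sumr exchange_big mulrCA.
Qed.

Lemma avg_cst N (c : R) : (0 < N)%N -> avg N (fun=> c) = c.
Proof.
move=> N0; rewrite /avg sumr_const card_ord -[c *+ N]mulr_natl mulrA mulVf ?mul1r//.
by rewrite pnatr_eq0 -lt0n.
Qed.

Lemma le_avg N a b : (forall n, (n < N)%N -> a n <= b n) -> avg N a <= avg N b.
Proof.
by move=> ab; rewrite /avg ler_wpM2l ?invr_ge0//; apply: ler_sum => i _; exact: ab.
Qed.

Lemma avg_ge0 N a : (forall n, 0 <= a n) -> 0 <= avg N a.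
Proof. by move=> a0; rewrite /avg mulr_ge0 ?invr_ge0 ?sumr_ge0. Qed.

Lemma ler_norm_avg N a : `|avg N a| <= avg N (fun n => `|a n|).
Proof.
by rewrite /avg normrM ger0_norm ?invr_ge0// ler_wpM2l ?invr_ge0// ler_norm_sum.
Qed.

Lemma avg_le_bound N a (B : R) : 0 <= B ->
  (forall n, (n < N)%N -> a n <= B) -> avg N a <= B.
Proof.
move=> B0 aB; have [->|N0] := posnP N; first by rewrite /avg big_ord0 mulr0.
by rewrite -[leRHS](avg_cst B N0); exact: le_avg.
Qed.

Lemma norm_avg_bound N a (B : R) : (forall n, `|a n| <= B) -> `|avg N a| <= B.
Proof.
move=> aB; rewrite (le_trans (ler_norm_avg _ _))// avg_le_bound//.
by rewrite (le_trans _ (aB 0%N)).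
Qed.

Lemma sqr_avg N a :
  avg N a ^+ 2 = avg N (fun n => avg N (fun m => a n * a m)).
Proof.
under [RHS]eq_avg do rewrite avgZ.
by rewrite /avg -mulr_suml mulrA expr2.
Qed.

(** Each unit shift exchanges two boundary terms. *)
Lemma avg_shift N h a (B : R) : (forall n, `|a n| <= B) ->
  `|avg N a - avg N (fun n => a (n + h)%N)| <= N%:R^-1 * (2 * B * h%:R).
Proof.
move=> aB; rewrite /avg -mulrBr normrM ger0_norm ?invr_ge0// ler_wpM2l ?invr_ge0//.
elim: h => [|h ih].
  under [X in _ - X]eq_bigr do rewrite addn0.
  by rewrite subrr normr0 mulr0.
have e : \sum_(n < N) a (n + h)%N + a (N + h)%N =
    a h + \sum_(n < N) a (n + h.+1)%N.
  rewrite -(big_ord_recr N (fun n => a (n + h)%N)) big_ord_recl /= add0n.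
  by congr (_ + _); apply: eq_bigr => i _; rewrite addnS.
have -> : \sum_(n < N) a n - \sum_(n < N) a (n + h.+1)%N =
    (\sum_(n < N) a n - \sum_(n < N) a (n + h)%N) + (a h - a (N + h)%N).
  by move: e; lra.
rewrite (le_trans (ler_normD _ _))// -(natr1 h) mulrDr mulr1 lerD//.
by rewrite (le_trans (ler_normB _ _))// mulr2n mulrDl mul1r lerD.
Qed.

(** Replacing each term by its average over a window of length [H] changes the
    mean by a boundary term only; convexity then brings the squares inside. *)
Lemma van_der_corput_ineq N H a (B : R) :
  (0 < H)%N -> (forall n, `|a n| <= B) ->
  avg N a ^+ 2 <=
    2 * avg H (fun h => avg H (fun h' =>
          avg N (fun n => a (n + h)%N * a (n + h')%N)))
    + 2 * (N%:R^-1 * (2 * B * H%:R)) ^+ 2.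
Proof.
move=> H0 aB; have B0 : 0 <= B by rewrite (le_trans _ (aB 0%N)).
pose A := avg N (fun n => avg H (fun h => a (n + h)%N)).
have dA : `|avg N a - A| <= N%:R^-1 * (2 * B * H%:R).
  rewrite /A exchange_avg -[avg N a](avg_cst _ H0) -mulN1r -avgZ -avgD.
  rewrite (le_trans (ler_norm_avg _ _))// avg_le_bound//.
    by rewrite !mulr_ge0 ?invr_ge0.
  move=> h hH; rewrite mulN1r (le_trans (avg_shift _ _ aB))//.
  by rewrite ler_wpM2l ?invr_ge0// ler_wpM2l ?mulr_ge0// ler_nat ltnW.
have A2 : A ^+ 2 <= avg H (fun h => avg H (fun h' =>
    avg N (fun n => a (n + h)%N * a (n + h')%N))).
  apply: (le_trans (sqr_avg_le N (fun n => avg H (fun h => a (n + h)%N)))).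
  rewrite -/(avg N (fun n => avg H (fun h => a (n + h)%N) ^+ 2)).
  under eq_avg do rewrite sqr_avg.
  rewrite exchange_avg.
  by under eq_avg do rewrite exchange_avg.
have d2 : (avg N a - A) ^+ 2 <= (N%:R^-1 * (2 * B * H%:R)) ^+ 2.
  rewrite -[leLHS]real_normK ?num_real// ler_pXn2r// nnegrE//.
  by rewrite !mulr_ge0 ?invr_ge0.
apply: (@le_trans _ _ (2 * A ^+ 2 + 2 * (avg N a - A) ^+ 2)); last by lra.
by have := sqr_ge0 (2 * A - avg N a); nra.
Qed.

(** * Counting near a line *)

(** All solutions lie in the window of length [K] that starts at the least one. *)
Lemma sum_window (K H : nat) (p : pred nat) :
  (forall h h', p h -> p h' -> h <= h' -> h' < h + K)%N ->
  \sum_(h < H) ((p h)%:R : R) <= K%:R.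
Proof.
move=> pK; rewrite -natr_sum ler_nat.
have [/existsP [h1 ph1]|/existsPn no] := boolP [exists h : 'I_H, p h]; last first.
  by rewrite big1// => h _; rewrite (negbTE (no h)).
have [h0 ph0 minh0] := ex_minnP (ex_intro _ (h1 : nat) ph1).
rewrite -(big_mkord xpredT (fun h => if p h then 1%N else 0%N)) -big_mkcond.
rewrite sum1_count -size_filter -[leqRHS](size_iota h0 K).
apply: uniq_leq_size; first exact/filter_uniq/iota_uniq.
move=> h; rewrite mem_filter mem_iota => /andP[ph _].
by rewrite minh0//= pK// minh0.
Qed.

End Avg.

Lemma sum_near_line (R : realType) (a C : R) : a != 0 ->
  exists K : nat, forall (H : nat) (t : R),
  \sum_(h < H) ((`|a * h%:R - t| <= C)%R%:R : R) <= K%:R.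
Proof.
move=> a0; exists (Num.truncn (2 * C / `|a|)).+1 => H t.
apply: (@sum_window _ _ _ (fun h => (`|a * h%:R - t| <= C)%R)) => h h' hh hh' le_hh'.
rewrite -ltn_subLR// -(ltr_nat R) (le_lt_trans _ (truncnS_gt _))//.
rewrite ler_pdivlMr ?normr_gt0// natrB//.
rewrite -[X in X * _]ger0_norm ?subr_ge0 ?ler_nat// -normrM.
rewrite (_ : _ * a = (a * h'%:R - t) - (a * h%:R - t)); last by ring.
by rewrite (le_trans (ler_normB _ _))// mulr2n mulrDl mul1r lerD.
Qed.

(** A line of nonzero slope passes near each integer a bounded number of times,
    so averages of [b] near the line are controlled by ordinary averages. *)
Lemma near_line_double_avg (R : realType) (b : int -> R) (a C : R) :
  a != 0 -> (forall m, 0 <= b m) ->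
  avg N (fun n => b n%:Z) @[N --> \oo] --> (0 : R) ->
  avg N (fun n => b (- n%:Z)) @[N --> \oo] --> (0 : R) ->
  forall e : R, 0 < e -> exists H (c : nat -> nat -> R), [/\ (0 < H)%N,
    forall h h' (m : int), (h < H)%N -> (h' < H)%N ->
      `|m%:~R - a * (h%:R - h'%:R)| <= C -> b m <= c h h' &
    avg H (fun h' => avg H (fun h => c h h')) <= e].
Proof.
move=> a0 b0 /cvg0_near bp /cvg0_near bn e e0.
have [K hK] := sum_near_line C a0.
pose L := (Num.truncn (`|a| + `|C|)).+1.
have hL : `|a| + `|C| <= L%:R by rewrite ltW// truncnS_gt.
(* Both one-sided averages are made smaller than [e / D]; a window of length [H]
   sees the line near integers of size at most [M], and [M.+1 <= L.+1 * H]. *)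
pose D : R := 2 * (K%:R * (L.+1)%:R) + 1.
have D0 : 0 < D by rewrite /D ltr_wpDl// !mulr_ge0.
have [N1 _ hN1] := bp _ (divr_gt0 e0 D0).
have [N2 _ hN2] := bn _ (divr_gt0 e0 D0).
pose H := (N1 + N2).+1; pose M := (L * H)%N.
pose near_line h h' (m : int) : R :=
  (`|m%:~R - a * (h%:R - h'%:R)| <= C)%R%:R.
pose c h h' := \sum_(j < M.+1) (near_line h h' j%:Z * b j%:Z +
                                near_line h h' (- j%:Z) * b (- j%:Z)).
have nl0 h h' m : 0 <= near_line h h' m by exact: ler0n.
exists H, c; split => //.
  move=> h h' m hH h'H hm.
  have nl1 : near_line h h' m = 1 by rewrite /near_line hm.
  have mM : (`|m| < M.+1)%N.
    rewrite ltnS -(ler_nat R) natrM.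
    rewrite -[(`|m|%N)%:R]/((`|m|%N)%:~R) abszE intr_norm.
    have -> : (m%:~R : R) = (m%:~R - a * (h%:R - h'%:R)) + a * (h%:R - h'%:R).
      by rewrite subrK.
    rewrite (le_trans (ler_normD _ _))//.
    apply: (@le_trans _ _ (`|C| + `|a| * H%:R)).
      rewrite lerD ?(le_trans hm) ?ler_norm// normrM ler_wpM2l//.
      move: hH h'H; rewrite -!(ltr_nat R) => hH h'H.
      have : 0 <= h%:R :> R by []. have : 0 <= h'%:R :> R by [].
      by rewrite ler_norml => *; apply/andP; split; lra.
    have H1 : 1 <= H%:R :> R by rewrite ler1n.
    have := normr_ge0 C; have := normr_ge0 a; nra.
  rewrite /c (bigD1 (Ordinal mM))//= -[leLHS]addr0 lerD//; last first.
    by apply: sumr_ge0 => j _; rewrite addr_ge0// mulr_ge0.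
  case: (leP 0 m) => m0.
    by rewrite gez0_abs// nl1 mul1r lerDl mulr_ge0.
  by rewrite ltz0_abs// opprK nl1 mul1r lerDr mulr_ge0.
have MH : (H <= M)%N by rewrite /M /L leq_pmull.
have bsum : \sum_(j < M.+1) (b j%:Z + b (- j%:Z)) <= M.+1%:R * (2 * (e / D)).
  have -> : \sum_(j < M.+1) (b j%:Z + b (- j%:Z)) =
      M.+1%:R * (avg M.+1 (fun n => b n%:Z) + avg M.+1 (fun n => b (- n%:Z))).
    by rewrite -avgD /avg mulrA mulfV ?mul1r// pnatr_eq0.
  rewrite ler_wpM2l// mulr2n mulrDl mul1r.
  have h1 := hN1 M.+1; have h2 := hN2 M.+1.
  rewrite lerD// (le_trans (ler_norm _))//.
    by apply: h1 => /=; rewrite /H in MH; lia.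
  by apply: h2 => /=; rewrite /H in MH; lia.
have inner h' : avg H (fun h => c h h') <= e.
  rewrite /avg ler_pdivrMl ?ltr0n//.
  rewrite exchange_big /=.
  apply: (@le_trans _ _ (\sum_(j < M.+1) K%:R * (b j%:Z + b (- j%:Z)))).
    apply: ler_sum => j _; rewrite big_split /= -!mulr_suml mulrDr.
    have nlK m : \sum_(h < H) near_line h h' m <= K%:R.
      apply: le_trans (hK H (m%:~R + a * h'%:R)); apply: ler_sum => h _.
      rewrite /near_line -normrN.
      rewrite (_ : - (m%:~R - a * (h%:R - h'%:R)) =
                   a * h%:R - (m%:~R + a * h'%:R))//.
      by ring.
    by rewrite lerD// ler_wpM2r.
  rewrite -mulr_sumr (le_trans (ler_wpM2l _ bsum))//.
  have ML : M.+1%:R <= L.+1%:R * H%:R :> R by rewrite -natrM ler_nat /M; lia.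
  have eD0 : 0 <= e / D by rewrite divr_ge0 ?ltW.
  apply: (@le_trans _ _ (H%:R * (2 * (K%:R * L.+1%:R) * (e / D)))).
    have kd : 0 <= K%:R * (2 * (e / D)) by apply: mulr_ge0 => //; lra.
    by have := ler_wpM2r kd ML; move: (e / D) => ed; lra.
  have eE : e = D * (e / D) by rewrite mulrCA mulfV ?mulr1// gt_eqF.
  rewrite [in leRHS]eE ler_wpM2l//.
  by move: (e / D) eD0 => ed ed0; rewrite /D; lra.
by apply: avg_le_bound => [|h' _]; [exact: ltW | exact: inner].
Qed.

(** * Van der Corput's lemma *)

Section VanDerCorput.
Context d (X : measurableType d) (R : realType) (P : probability X R).

Lemma bounded_measurable_avg N (u : nat -> X -> R) :
  (forall n, bounded_measurable (u n)) ->
  bounded_measurable (fun x => avg N (u^~ x)).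
Proof.
move=> bu; apply: bounded_measurableZ.
by apply: bounded_measurable_sum => i; exact: bu.
Qed.

Lemma mean_avg N (u : nat -> X -> R) : (forall n, bounded_measurable (u n)) ->
  \int[P]_x avg N (u^~ x) = avg N (fun n => \int[P]_x u n x).
Proof.
move=> bu; rewrite meanZ ?mean_sum//.
by apply: bounded_measurable_sum => i; exact: bu.
Qed.

(** The window length [H] and the bound [c] on the limiting correlations may both
    depend on the precision [e], as [near_line_double_avg] will provide them. *)
Lemma van_der_corput (u : nat -> X -> R) (B : R) :
  (forall n, bounded_measurable (u n)) -> (forall n x, `|u n x| <= B) ->
  (forall e : R, 0 < e -> exists H (c : nat -> nat -> R), [/\ (0 < H)%N,
    forall h h', (h < H)%N -> (h' < H)%N -> \forall N \near \oo,
      avg N (fun n => \int[P]_x (u (n + h)%N x * u (n + h')%N x)) <= c h h' + e &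
    avg H (fun h => avg H (fun h' => c h h')) <= e]) ->
  \int[P]_x `|avg N (u^~ x)| @[N --> \oo] --> (0 : R).
Proof.
move=> bu uB cor; apply/cvg0_near => e e0.
(* The correlations contribute twice [e^2/8 + e^2/8], the boundary term [r]
   twice [e^2/4]. *)
have e80 : 0 < e ^+ 2 / 8 by rewrite divr_gt0 ?exprn_gt0.
have [H [c [H0 hc cavg]]] := cor _ e80.
have B0 : 0 <= B by rewrite (le_trans _ (uB 0%N point)).
have : \forall N \near \oo, forall hh : 'I_H * 'I_H,
    avg N (fun n => \int[P]_x (u (n + hh.1)%N x * u (n + hh.2)%N x))
      <= c hh.1 hh.2 + e ^+ 2 / 8.
  by apply: filter_forall => hh; exact: hc.
move=> nearc; near=> N.
have N0 : (0 < N)%N by near: N; exact: nbhs_infty_gt.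
have bA := bounded_measurable_avg N bu.
apply: norm_le_of_sqr; first exact: ltW.
apply: (le_trans (sqr_mean_le P (bounded_measurable_norm bA))).
under eq_Rintegral do rewrite real_normK ?num_real//.
have buu h h' n : bounded_measurable (fun x => u (n + h)%N x * u (n + h')%N x).
  exact: bounded_measurableM.
pose V x := avg H (fun h => avg H (fun h' =>
  avg N (fun n => u (n + h)%N x * u (n + h')%N x))).
pose r := N%:R^-1 * (2 * B * H%:R).
have bV : bounded_measurable V.
  do 3 apply: bounded_measurable_avg => ?; exact: buu.
apply: (@le_trans _ _ (\int[P]_x (2 * V x + 2 * r ^+ 2))).
  apply: le_mean.
  - exact: bounded_measurable_sqr.
  - apply: bounded_measurableD; first exact: bounded_measurableZ.
    exact: bounded_measurable_cst.
  - by move=> x; apply: (van_der_corput_ineq _ H0 (uB^~ x)).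
rewrite meanD; [|exact: bounded_measurableZ|exact: bounded_measurable_cst].
rewrite meanZ// mean_cst.
have VE : \int[P]_x V x <= e ^+ 2 / 8 + e ^+ 2 / 8.
  rewrite /V mean_avg => [|h]; last by do 2 apply: bounded_measurable_avg => ?.
  apply: le_trans (_ : avg H (fun h => avg H (fun h' => c h h' + e ^+ 2 / 8)) <= _).
    apply: le_avg => h hH; rewrite mean_avg => [|h']; last first.
      exact: bounded_measurable_avg.
    apply: le_avg => h' h'H; rewrite mean_avg//.
    by apply: (near nearc N _ (Ordinal hH, Ordinal h'H)).
  under eq_avg do rewrite avgD avg_cst//.
  by rewrite avgD avg_cst// lerD2r.
have r2 : r ^+ 2 <= (e / 2) ^+ 2.
  have r0 : 0 <= r by rewrite /r !mulr_ge0 ?invr_ge0.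
  have e2 : 0 < e / 2 by rewrite divr_gt0.
  rewrite ler_pXn2r ?nnegrE ?(ltW e2)// /r ler_pdivrMl ?ltr0n// [leRHS]mulrC.
  by near: N; apply: near_le_natr; rewrite divr_gt0.
by have := r2; rewrite expr_div_n; lra.
Unshelve. all: by end_near. Qed.

End VanDerCorput.

(** * Integer powers of the transformation *)

Section Iterz.
Context (X : Type) (T Tinv : X -> X).
Hypotheses (TK : cancel T Tinv) (TinvK : cancel Tinv T).

Lemma iterzS m x : iterz T Tinv (m + 1) x = T (iterz T Tinv m x).
Proof.
case: m => [n|[|n]]; first by rewrite -PoszD addn1.
  by rewrite /= TinvK.
have -> : Negz n.+1 + 1 = Negz n by lia.
by rewrite /= TinvK.
Qed.

Lemma iterz_pred m x : iterz T Tinv (m - 1) x = Tinv (iterz T Tinv m x).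
Proof. by rewrite -{2}(subrK 1 m) iterzS TK. Qed.

Lemma iterzD m n x : iterz T Tinv (m + n) x = iterz T Tinv m (iterz T Tinv n x).
Proof.
elim/int_ind: m => [|m ih|m ih]; first by rewrite add0r.
  by rewrite -addn1 PoszD addrAC !iterzS ih.
by rewrite -addn1 PoszD opprD addrAC !iterz_pred ih.
Qed.

Lemma iterzN m x : iterz T Tinv (- m) (iterz T Tinv m x) = x.
Proof. by rewrite -iterzD addNr. Qed.

End Iterz.

(** * Finitely coloured families of observables *)

Section Coloured.
Context d (X : measurableType d) (R : realType).
Implicit Types f g : nat -> X -> R.

(** Observables that vary with time, but among finitely many functions: this is
    what the bounded fluctuations of the exponents around linear sequences
    produce after van der Corput's differencing. *)
Definition finitely_coloured f : Prop :=
  exists (I : finType) (G : I -> X -> R) (kappa : nat -> I),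
    (forall i, bounded_measurable (G i)) /\ (forall n, f n = G (kappa n)).

Lemma finitely_coloured_cst (g : X -> R) : bounded_measurable g ->
  finitely_coloured (fun=> g).
Proof. by move=> bg; exists unit, (fun=> g), (fun=> tt). Qed.

Lemma finitely_colouredM f g : finitely_coloured f -> finitely_coloured g ->
  finitely_coloured (fun n x => f n x * g n x).
Proof.
move=> [I [G [k [bG fG]]]] [J [G' [k' [bG' gG']]]].
exists (I * J)%type, (fun ij x => G ij.1 x * G' ij.2 x),
  (fun n => (k n, k' n)); split => [ij|n]; first exact: bounded_measurableM.
by rewrite fG gG'.
Qed.

Lemma finitely_coloured_shift f h : finitely_coloured f ->
  finitely_coloured (fun n => f (n + h)%N).
Proof.
move=> [I [G [k [bG fG]]]]; exists I, G, (fun n => k (n + h)%N); by split.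
Qed.

Lemma finitely_coloured_measurable f : finitely_coloured f ->
  forall n, bounded_measurable (f n).
Proof. by move=> [I [G [k [bG fG]]]] n; rewrite fG. Qed.

Lemma finite_bounded (I : finType) (G : I -> X -> R) :
  (forall i, bounded_measurable (G i)) ->
  exists2 B : R, 0 <= B & forall i x, `|G i x| <= B.
Proof.
move=> bG; have /choice [M hM] : forall i, exists M : R, forall x, `|G i x| <= M.
  by move=> i; have [] := bG i.
exists (\sum_i `|M i|) => [|i x]; first exact: sumr_ge0.
rewrite (le_trans (hM i x))// (le_trans (ler_norm _))// (bigD1 i)//= lerDl.
exact: sumr_ge0.
Qed.

Lemma finitely_coloured_bounded f : finitely_coloured f ->
  exists2 B : R, 0 <= B & forall n x, `|f n x| <= B.
Proof.
move=> [I [G [k [bG fG]]]]; have [B B0 hB] := finite_bounded bG.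
by exists B => // n x; rewrite fG.
Qed.

(** Subtracting the mean of the current colour keeps the colours finite in
    number. *)
Lemma finitely_coloured_centre (P : probability X R) f : finitely_coloured f ->
  finitely_coloured (fun n x => f n x - \int[P]_y f n y).
Proof.
move=> [I [G [k [bG fG]]]].
exists I, (fun i x => G i x - \int[P]_y G i y), k; split => [i|n].
  by apply: bounded_measurableB; last exact: bounded_measurable_cst.
by rewrite fG.
Qed.

(** Bounded integers [e n] are themselves colours, hence the index set
    [I * 'I_(C + C).+1]; the shift by [C] makes them natural numbers. *)
Lemma finitely_coloured_move (s : int -> X -> X) (C : nat) f (e : nat -> int) :
  (forall m, measurable_fun setT (s m)) ->
  (forall n, `|e n| <= C%:Z) -> finitely_coloured f ->
  finitely_coloured (fun n x => f n (s (e n) x)).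
Proof.
move=> ms eC [I [G [k [bG fG]]]].
exists (I * 'I_(C + C).+1)%type, (fun (ic : I * 'I_(C + C).+1) x =>
  G ic.1 (s (ic.2%:Z - C%:Z) x)),
  (fun n => (k n, inord (absz (e n + C%:Z)))); split => [ic|n].
  exact: (bounded_measurable_comp (ms _)).
apply/funext => x /=; rewrite fG inordK; last by have := eC n; lia.
by congr (G _ (s _ x)); have := eC n; lia.
Qed.

End Coloured.

(** * Joint averages *)

Section Joint.
Context d (X : measurableType d) (R : realType) (P : probability X R).
Variables (T Tinv : X -> X).
Hypothesis hT : invertible_measure_preserving P T Tinv.
Hypothesis wmT : weakly_mixing P T.

Local Notation tau := (iterz T Tinv).

Let TK : cancel T Tinv. Proof. by have [] := hT. Qed.
Let TinvK : cancel Tinv T. Proof. by have [] := hT. Qed.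
Let mpT : measure_preserving P T. Proof. by have [] := hT. Qed.

Lemma measure_preserving_iterz m : measure_preserving P (tau m).
Proof.
have [_ _ mTinv _] := hT; have [mT pT] := mpT.
have mpTinv : measure_preserving P Tinv.
  split => // A mA; have mA' : measurable (Tinv @^-1` A).
    by rewrite -[X in measurable X]setTI; exact: mTinv.
  rewrite -pT//; congr (P _); apply/seteqP; split => x /=; rewrite TK//.
have it (S : X -> X) n : measure_preserving P S -> measure_preserving P (iter n S).
  move=> [mS pS]; split; first exact: (measurable_iter (conj mS pS)).
  elim: n => [//|n ih] A mA; rewrite -[RHS]pS// -[RHS]ih//.
  by rewrite -[X in measurable X]setTI; exact: mS.
by case: m => n; exact: it.
Qed.

Let mtau m : measurable_fun setT (tau m).
Proof. by have [] := measure_preserving_iterz m. Qed.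

Lemma mean_iterz m (f : X -> R) : bounded_measurable f ->
  \int[P]_x f (tau m x) = \int[P]_x f x.
Proof. exact: mean_measure_preserving (measure_preserving_iterz m). Qed.

(** The factor [T^(pos n) (obs n)] of a joint average at time [n]; [slope] is that
    of the line near which the exponents will be required to stay. *)
Record factor := Factor {
  slope : R;
  pos : nat -> int;
  obs : nat -> X -> R }.

Definition good_factor (p : factor) : Prop :=
  (exists C : nat, forall n, `|(pos p n)%:~R - slope p * n%:R| <= C%:R) /\
  finitely_coloured (obs p).

Fixpoint good_factors (l : seq factor) : Prop :=
  if l is p :: l' then good_factor p /\ good_factors l' else True.

Definition joint_prod (l : seq factor) (n : nat) (x : X) : R :=
  \prod_(p <- l) obs p n (tau (pos p n) x).

Definition mean_prod_factors (l : seq factor) (n : nat) : R :=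
  \prod_(p <- l) \int[P]_x obs p n x.

Lemma bounded_measurable_factor p n : good_factor p ->
  bounded_measurable (fun x => obs p n (tau (pos p n) x)).
Proof.
move=> [_ fc]; apply: (bounded_measurable_comp (mtau _)).
exact: finitely_coloured_measurable.
Qed.

Lemma bounded_measurable_joint_prod l n : good_factors l ->
  bounded_measurable (joint_prod l n).
Proof.
rewrite /joint_prod; elim: l => [_|p l ih /= [gp gl]].
  by under eq_fun do rewrite big_nil; exact: bounded_measurable_cst.
under eq_fun do rewrite big_cons; apply: bounded_measurableM; last exact: ih.
exact: bounded_measurable_factor.
Qed.

Lemma joint_prod_bounded l : good_factors l ->
  exists2 B : R, 0 <= B & forall n x, `|joint_prod l n x| <= B.
Proof.
elim: l => [_|p l ih /= [[_ fc] gl]].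
  by exists 1 => // n x; rewrite /joint_prod big_nil normr1.
have [B B0 hB] := ih gl; have [C C0 hC] := finitely_coloured_bounded fc.
exists (C * B); first exact: mulr_ge0.
by move=> n x; rewrite /joint_prod big_cons normrM ler_pM//; exact: hB.
Qed.

Definition bounded_seq (w : nat -> R) := exists B : R, forall n, `|w n| <= B.

(** All bounded weights are allowed, so that an indicator of a set of times, or
    the mean of a split-off factor, can be absorbed into them. *)
Definition jointly_mixing (l : seq factor) : Prop :=
  forall w, bounded_seq w ->
  \int[P]_x `|avg N (fun n => w n * (joint_prod l n x - mean_prod_factors l n))|
    @[N --> \oo] --> (0 : R).

(** The weights absorb the colours of [F]: on the times of a given colour, [F]
    is a fixed function. *)
Lemma pairing_cvg0 (F D : nat -> X -> R) (w : nat -> R) :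
  finitely_coloured F -> (forall n, bounded_measurable (D n)) -> bounded_seq w ->
  (forall w, bounded_seq w ->
    \int[P]_x `|avg N (fun n => w n * D n x)| @[N --> \oo] --> (0 : R)) ->
  avg N (fun n => w n * \int[P]_x (F n x * D n x)) @[N --> \oo] --> (0 : R).
Proof.
move=> [I [G [k [bG FG]]]] bD [W hW] Dw.
have [B B0 hB] := finite_bounded bG.
pose v i n : R := w n * (k n == i)%:R.
have bv i : bounded_seq (v i).
  exists W => n; rewrite /v; case: eqP => _; rewrite ?mulr1//.
  by rewrite mulr0 normr0 (le_trans _ (hW n)).
have bA i N : bounded_measurable (fun x => avg N (fun n => v i n * D n x)).
  by apply: bounded_measurable_avg => n; exact: bounded_measurableZ.
have E N : avg N (fun n => w n * \int[P]_x (F n x * D n x)) =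
    \sum_i \int[P]_x (G i x * avg N (fun n => v i n * D n x)).
  transitivity (\sum_i avg N (fun n => v i n * \int[P]_x (G i x * D n x))).
    rewrite -avg_sum; apply: eq_avg => n.
    rewrite (bigD1 (k n))//= big1 ?addr0 => [|i ik].
      by rewrite /v eqxx mulr1 FG.
    by rewrite /v eq_sym (negbTE ik) mulr0 mul0r.
  apply: eq_bigr => i _.
  under [RHS]eq_Rintegral do rewrite -avgZ.
  rewrite mean_avg => [|n]; last first.
    by apply: bounded_measurableM => //; exact: bounded_measurableZ.
  apply: eq_avg => n; rewrite -meanZ; last exact: bounded_measurableM.
  by apply: eq_Rintegral => x _; rewrite mulrCA.
apply: (@cvg0_squeeze _ _
  (fun N => \sum_i B * \int[P]_x `|avg N (fun n => v i n * D n x)|)).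
2: by apply: cvg0_sum => i; apply: cvg0Z; exact: Dw.
near=> N; rewrite E (le_trans (ler_norm_sum _ _ _))//.
apply: ler_sum => i _.
have bGA := bounded_measurableM (bG i) (bA i N).
rewrite (le_trans (le_norm_mean P bGA))// -meanZ; last exact: bounded_measurable_norm.
apply: le_mean => [||x].
- exact: bounded_measurable_norm.
- by apply: bounded_measurableZ; exact: bounded_measurable_norm.
- by rewrite normrM ler_wpM2r.
Unshelve. all: by end_near. Qed.

(** One sequence [b] dominates the correlations at lag [m] of all pairs of
    colours; negative lags reduce to positive ones by exchanging the pair. *)
Lemma coloured_correlation (f : nat -> X -> R) : finitely_coloured f ->
  (forall n, \int[P]_x f n x = 0) ->
  exists b : int -> R, [/\ forall m, 0 <= b m,
    avg N (fun n => b n%:Z) @[N --> \oo] --> (0 : R),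
    avg N (fun n => b (- n%:Z)) @[N --> \oo] --> (0 : R) &
    forall n n' m, `|\int[P]_x (f n (tau m x) * f n' x)| <= b m].
Proof.
move=> [I [G [k [bG fG]]]] f0.
(* Centring the colours changes none that occurs. *)
pose G0 i x := G i x - \int[P]_y G i y.
have bG0 i : bounded_measurable (G0 i).
  by apply: bounded_measurableB => //; exact: bounded_measurable_cst.
have G00 i : \int[P]_x G0 i x = 0.
  by rewrite meanB ?mean_cst ?subrr//; exact: bounded_measurable_cst.
have fG0 n : f n = G0 (k n) by apply/funext => x; rewrite /G0 -fG f0 subr0.
pose b m := \sum_i \sum_j `|\int[P]_x (G0 i (tau m x) * G0 j x)|.
exists b; split.
- by move=> m; rewrite sumr_ge0// => i _; rewrite sumr_ge0.
- apply: (@cvg0_squeeze _ _ (fun N => \sum_i \sum_j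
    avg N (fun n => `|\int[P]_x (G0 i (iter n T x) * G0 j x)|))); last first.
    apply: cvg0_sum => i; apply: cvg0_sum => j.
    exact: (weakly_mixing_correlation mpT wmT).
  apply: nearW => N; rewrite ger0_norm; last first.
    by apply: avg_ge0 => n; rewrite sumr_ge0// => i _; rewrite sumr_ge0.
  rewrite avg_sum; apply: ler_sum => i _.
  by rewrite avg_sum; apply: ler_sum => j _.
- apply: (@cvg0_squeeze _ _ (fun N => \sum_i \sum_j
    avg N (fun n => `|\int[P]_x (G0 j (iter n T x) * G0 i x)|))); last first.
    apply: cvg0_sum => i; apply: cvg0_sum => j.
    exact: (weakly_mixing_correlation mpT wmT).
  apply: nearW => N; rewrite ger0_norm; last first.
    by apply: avg_ge0 => n; rewrite sumr_ge0// => i _; rewrite sumr_ge0.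
  rewrite avg_sum; apply: ler_sum => i _.
  rewrite avg_sum; apply: ler_sum => j _; apply: le_avg => n _.
  rewrite -(@mean_iterz n%:Z).
    rewrite le_eqVlt; apply/orP; left; apply/eqP; congr `|_|.
    by apply: eq_Rintegral => x _; rewrite (iterzN TK TinvK) mulrC.
  by apply: bounded_measurableM => //; exact: (bounded_measurable_comp (mtau _)).
- move=> n n' m; rewrite !fG0 /b (bigD1 (k n))//= (bigD1 (k n'))//= -addrA lerDl.
  by rewrite addr_ge0// sumr_ge0// => i _; rewrite sumr_ge0.
Qed.

(** Multiplying the joint product at times [n + h] and [n + h'] and moving the
    origin along the orbit by [pos p0 n] gives a joint product again; its
    exponents are the differences [pos p - pos p0]. *)
Definition differenced (p0 : factor) (h h' : nat) (p : factor) : factor :=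
  Factor (slope p - slope p0) (fun n => pos p n - pos p0 n)
    (fun n x => obs p (n + h)%N (tau (pos p (n + h)%N - pos p n) x) *
                obs p (n + h')%N (tau (pos p (n + h')%N - pos p n) x)).

Lemma finitely_coloured_increment p h : good_factor p ->
  finitely_coloured
    (fun n x => obs p (n + h)%N (tau (pos p (n + h)%N - pos p n) x)).
Proof.
move=> [[C hC] fc].
apply: (@finitely_coloured_move _ _ _ tau
  (Num.truncn (C%:R + C%:R + `|slope p| * h%:R : R)).+1 (fun n => obs p (n + h)%N)
  (fun n => pos p (n + h)%N - pos p n)) => //.
- move=> n; rewrite -(ler_int R) intr_norm intrB (le_trans _ (ltW (truncnS_gt _)))//.
  have -> : (pos p (n + h)%N)%:~R - (pos p n)%:~R =
    (((pos p (n + h)%N)%:~R - slope p * (n + h)%:R) -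
     ((pos p n)%:~R - slope p * n%:R)) + slope p * h%:R.
    by rewrite natrD; ring.
  rewrite (le_trans (ler_normD _ _))// lerD//; last first.
    by rewrite normrM (ger0_norm (ler0n _ _)).
  by rewrite (le_trans (ler_normB _ _))// lerD.
- exact: finitely_coloured_shift.
Qed.

Lemma good_differenced p0 h h' p : good_factor p0 -> good_factor p ->
  good_factor (differenced p0 h h' p).
Proof.
move=> gp0 gp; split; last first.
  by apply: finitely_colouredM; exact: finitely_coloured_increment.
have [[C0 hC0] _] := gp0; have [[C hC] _] := gp.
exists (C + C0)%N => n /=; rewrite intrB natrD.
have -> : (pos p n)%:~R - (pos p0 n)%:~R - (slope p - slope p0) * n%:R =
  ((pos p n)%:~R - slope p * n%:R) - ((pos p0 n)%:~R - slope p0 * n%:R).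
  by ring.
by rewrite (le_trans (ler_normB _ _))// lerD.
Qed.

Lemma good_factors_differenced p0 h h' l : good_factor p0 -> good_factors l ->
  good_factors (map (differenced p0 h h') l).
Proof.
move=> gp0; elim: l => //= p l ih [gp gl]; split; last exact: ih.
exact: good_differenced.
Qed.

Lemma uniq_slope_differenced p0 h h' l : uniq (0 :: map slope (p0 :: l)) ->
  uniq (0 :: map slope (map (differenced p0 h h') l)).
Proof.
rewrite /= => /andP[_ /andP[p0l ul]].
have -> : map slope (map (differenced p0 h h') l) =
    map (fun a => a - slope p0) (map slope l) by rewrite -!map_comp.
rewrite (map_inj_uniq (addIr _)) ul andbT.
apply: contra p0l => /mapP[a al /esym/eqP]; rewrite subr_eq0 => /eqP <- //.
Qed.

Lemma joint_prod_differenced p0 h h' l n x :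
  joint_prod l (n + h) x * joint_prod l (n + h') x =
  joint_prod (map (differenced p0 h h') l) n (tau (pos p0 n) x).
Proof.
rewrite /joint_prod -big_split big_map; apply: eq_bigr => p _ /=.
rewrite -!(iterzD TK TinvK).
by congr (obs _ _ (tau _ _) * obs _ _ (tau _ _)); ring.
Qed.

(** The bound has to be uniform in [h] and [h'], because the window of van der
    Corput's lemma is chosen after it. *)
Lemma mean_prod_differenced_bounded p0 l : good_factors l ->
  exists2 B : R, 0 <= B & forall h h' n,
    `|mean_prod_factors (map (differenced p0 h h') l) n| <= B.
Proof.
elim: l => [_|p l ih /= [gp gl]].
  by exists 1 => // h h' n; rewrite /mean_prod_factors big_nil normr1.
have [B B0 hB] := ih gl; have [C C0 hC] := finitely_coloured_bounded gp.2.
exists (C * C * B); first by rewrite !mulr_ge0.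
move=> h h' n; rewrite /mean_prod_factors big_cons normrM ler_pM//; last exact: hB.
apply: norm_mean_le => [|x]; last by rewrite normrM ler_pM.
apply: finitely_coloured_measurable.
by apply: finitely_colouredM; exact: finitely_coloured_increment.
Qed.

(** Only the difference of the two displacements matters, by invariance. *)
Lemma mean_differenced_head p0 h h' n : good_factor p0 ->
  \int[P]_x obs (differenced p0 h h' p0) n x =
  \int[P]_x (obs p0 (n + h)%N (tau (pos p0 (n + h)%N - pos p0 (n + h')%N) x) *
             obs p0 (n + h')%N x).
Proof.
move=> [_ fc]; have bo := finitely_coloured_measurable fc.
rewrite -[RHS](@mean_iterz (pos p0 (n + h')%N - pos p0 n)).
  apply: eq_Rintegral => x _ /=; rewrite -(iterzD TK TinvK).
  by congr (obs _ _ (tau _ _) * _); ring.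
by apply: bounded_measurableM => //; exact: (bounded_measurable_comp (mtau _)).
Qed.

(** Van der Corput's lemma turns [l] into the list of its differenced factors,
    which has distinct nonzero slopes and to which the induction hypothesis
    applies; what remains is the mean of the differenced head. *)
Lemma joint_head_mean0 p0 l : good_factor p0 -> good_factors l ->
  uniq (0 :: map slope (p0 :: l)) -> (forall n, \int[P]_x obs p0 n x = 0) ->
  (forall l', size l' = size l -> good_factors l' ->
     uniq (0 :: map slope l') -> jointly_mixing l') ->
  forall w, bounded_seq w ->
  \int[P]_x `|avg N (fun n => w n * joint_prod (p0 :: l) n x)|
    @[N --> \oo] --> (0 : R).
Proof.
move=> gp0 gl us mean0 IH w [W hW].
have gpl : good_factors (p0 :: l) by [].
have W0 : 0 <= W by rewrite (le_trans _ (hW 0%N)).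
have [B B0 hB] := joint_prod_bounded gpl.
have [M M0 hM] := mean_prod_differenced_bounded p0 gl.
have [b [b0 bp bn hb]] := coloured_correlation gp0.2 mean0.
have [[C hC] fc0] := gp0.
have slope0 : slope p0 != 0.
  by move: us => /=; rewrite inE negb_or eq_sym => /andP[/andP[]].
have bJ n : bounded_measurable (joint_prod (p0 :: l) n).
  exact: bounded_measurable_joint_prod.
apply: (@van_der_corput _ _ _ _ _ (W * B)).
- by move=> n; exact: bounded_measurableZ.
- by move=> n x; rewrite normrM ler_pM.
(* [W * W * M] bounds all that multiplies the mean of the differenced head; the
   added [1] makes [K] positive. *)
move=> e e0; pose K := W * W * M + 1.
have K0 : 0 < K by rewrite /K ltr_wpDl// !mulr_ge0.
have [H [c [H0 hc cavg]]] :=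
  near_line_double_avg (C + C)%:R slope0 b0 bp bn (divr_gt0 e0 K0).
exists H, (fun h h' => K * c h h'); split => //; last first.
  under eq_avg do rewrite avgZ.
  by rewrite avgZ exchange_avg mulrC -ler_pdivlMr.
move=> h h' hH h'H.
pose l' := map (differenced p0 h h') l.
have gl' : good_factors l' by exact: good_factors_differenced.
pose F := obs (differenced p0 h h' p0).
have fcF : finitely_coloured F by have [] := good_differenced h h' gp0 gp0.
have bF := finitely_coloured_measurable fcF.
have bJ' n := bounded_measurable_joint_prod n gl'.
pose w' n := w (n + h)%N * w (n + h')%N.
have hw' n : `|w' n| <= W * W by rewrite normrM ler_pM.
pose m' := mean_prod_factors l'.
have E n : \int[P]_x ((w (n + h)%N * joint_prod (p0 :: l) (n + h) x) *
                      (w (n + h')%N * joint_prod (p0 :: l) (n + h') x)) =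
    w' n * \int[P]_x (F n x * (joint_prod l' n x - m' n)) +
    (w' n * m' n) * \int[P]_x F n x.
  transitivity (w' n * \int[P]_x (F n x * joint_prod l' n x)).
    have bFJ := bounded_measurableM (bF n) (bJ' n).
    rewrite -(mean_iterz (pos p0 n) bFJ).
    rewrite -meanZ; last first.
      exact: (bounded_measurable_comp (mtau _) bFJ).
    apply: eq_Rintegral => x _.
    rewrite mulrACA (joint_prod_differenced p0) /joint_prod big_cons.
    by rewrite [pos (differenced _ _ _ _) n]subrr.
  under [in RHS]eq_Rintegral do rewrite mulrBr [F n _ * m' n]mulrC.
  rewrite meanB; [|exact: bounded_measurableM|exact: bounded_measurableZ].
  by rewrite meanZ//; ring.
have l'mix : jointly_mixing l'.
  by apply: IH => //; [rewrite size_map | exact: uniq_slope_differenced].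
have cv0 : avg N (fun n => w' n * \int[P]_x (F n x * (joint_prod l' n x - m' n)))
    @[N --> \oo] --> (0 : R).
  apply: pairing_cvg0 => //; last by exists (W * W).
  by move=> n; apply: bounded_measurableB => //; exact: bounded_measurable_cst.
move/cvg0_near : cv0 => /(_ e e0); apply: filterS => N hN.
under eq_avg do rewrite E.
rewrite avgD addrC lerD//; last by rewrite (le_trans (ler_norm _)).
rewrite (le_trans (ler_norm _))//; apply: norm_avg_bound => n.
have hFc : `|\int[P]_x F n x| <= c h h'.
  rewrite mean_differenced_head// (le_trans (hb _ _ _))// hc//.
  rewrite intrB.
  have -> : (pos p0 (n + h)%N)%:~R - (pos p0 (n + h')%N)%:~R -
      slope p0 * (h%:R - h'%:R) =
    ((pos p0 (n + h)%N)%:~R - slope p0 * (n + h)%:R) -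
    ((pos p0 (n + h')%N)%:~R - slope p0 * (n + h')%:R).
    by rewrite !natrD; ring.
  by rewrite (le_trans (ler_normB _ _))// [(C + C)%:R]natrD lerD.
have c0 : 0 <= c h h' by rewrite (le_trans _ hFc).
rewrite 2!normrM; apply: (@le_trans _ _ (W * W * M * c h h')).
  by rewrite ler_pM ?mulr_ge0// ler_pM//; exact: hM.
by rewrite ler_wpM2r// /K lerDl.
Qed.

(** Centring the head: the discarded mean joins the weights of the tail. *)
Lemma jointly_mixing_of_slopes l : good_factors l ->
  uniq (0 :: map slope l) -> jointly_mixing l.
Proof.
move: {2}(size l) (erefl (size l)) => k; elim: k l => [|k ih] l.
  move=> /size0nil -> _ _ w _.
  apply: (@cvg0_squeeze _ _ (fun=> 0)); last exact: cvg_cst.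
  apply: nearW => N; under eq_Rintegral => x _.
    rewrite [avg _ _](_ : _ = 0) ?normr0; first over.
    by rewrite /avg big1 ?mulr0// => n _; rewrite /joint_prod /mean_prod_factors
      !big_nil subrr mulr0.
  by rewrite mean_cst normr0.
case: l => [//|p l] [sl] gl ul w bw; have [gp gl'] := gl; have [[C hC] fc] := gp.
have [B hB] := bw; have [M M0 hM] := finitely_coloured_bounded fc.
pose m n := \int[P]_x obs p n x.
have mM n : `|m n| <= M.
  by apply: norm_mean_le => //; exact: finitely_coloured_measurable.
pose p' := Factor (slope p) (pos p) (fun n x => obs p n x - m n).
have gp' : good_factor p'.
  by split; [exists C | exact: finitely_coloured_centre].
have mean0 n : \int[P]_x obs p' n x = 0.
  rewrite /= meanB ?mean_cst ?subrr//; last exact: bounded_measurable_cst.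
  exact: finitely_coloured_measurable.
have head := joint_head_mean0 gp' gl' ul mean0.
have {}head := head (fun l' sl' => ih l' (etrans sl' sl)) w bw.
have bwm : bounded_seq (fun n => w n * m n).
  by exists (B * M) => n; rewrite normrM ler_pM.
have ul' : uniq (0 :: map slope l).
  by move: ul => /=; rewrite inE negb_or => /andP[/andP[_ ->] /andP[_ ->]].
have tail := ih l sl gl' ul' _ bwm.
pose A N x := avg N (fun n => w n * joint_prod (p' :: l) n x).
pose D N x := avg N (fun n => (w n * m n) *
  (joint_prod l n x - mean_prod_factors l n)).
have bA N : bounded_measurable (A N).
  apply: bounded_measurable_avg => n; apply: bounded_measurableZ.
  exact: bounded_measurable_joint_prod.
have bD N : bounded_measurable (D N).
  apply: bounded_measurable_avg => n; apply: bounded_measurableZ.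
  apply: bounded_measurableB; last exact: bounded_measurable_cst.
  exact: bounded_measurable_joint_prod.
have E N x : avg N (fun n => w n * (joint_prod (p :: l) n x -
    mean_prod_factors (p :: l) n)) = A N x + D N x.
  rewrite -avgD; apply: eq_avg => n.
  by rewrite /joint_prod /mean_prod_factors !big_cons /= -/(m n); ring.
apply: (@cvg0_squeeze _ _ (fun N => \int[P]_x `|A N x| + \int[P]_x `|D N x|)).
  apply: nearW => N; under eq_Rintegral do rewrite E.
  have bAD := bounded_measurableD (bA N) (bD N).
  rewrite ger0_norm ?Rintegral_ge0//.
  rewrite -meanD; [|exact: bounded_measurable_norm..].
  apply: le_mean => [||x]; last exact: ler_normD.
    exact: bounded_measurable_norm.
  by apply: bounded_measurableD; exact: bounded_measurable_norm.
exact: cvg0D.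
Qed.

End Joint.

(** * Generalized linear functions are nearly linear *)

Lemma floor_dist (R : realType) (x : R) : `|(Num.floor x)%:~R - x| <= 1.
Proof.
have := floor_le x; have := floorD1_gt x; rewrite intrD.
by rewrite ler_norml => *; apply/andP; split; lra.
Qed.

Lemma gen_linear_near_linear (R : realType) (g : R -> R) : gen_linear g ->
  exists a C : R, forall x, `|g x - a * x| <= C.
Proof.
elim=> [a b|f h _ [a [C hC]] _ [a' [C' hC']]|c f _ [a [C hC]]|f _ [a [C hC]]].
- by exists a, `|b| => x; rewrite addrAC subrr add0r.
- exists (a + a'), (C + C') => x.
  rewrite (_ : _ - _ = (f x - a * x) + (h x - a' * x)); last by ring.
  by rewrite (le_trans (ler_normD _ _))// lerD.
- exists (c * a), (`|c| * C) => x.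
  by rewrite -mulrA -mulrBr normrM ler_wpM2l.
- exists a, (1 + C) => x.
  rewrite (_ : _ - _ = ((Num.floor (f x))%:~R - f x) + (f x - a * x)); last by ring.
  by rewrite (le_trans (ler_normD _ _))// lerD// floor_dist.
Qed.

Lemma unbounded_slope (R : realType) (phi : int -> int) (a C : R) :
  unbounded_int phi -> (forall n, `|(phi n)%:~R - a * n%:~R| <= C) -> a != 0.
Proof.
move=> unb hC; apply/eqP => a0; apply: unb.
exists (Num.floor C + 1)%R => n; have := hC n; rewrite a0 mul0r subr0 => h.
by rewrite -(ler_int R) intr_norm (le_trans h)// ltW// floorD1_gt.
Qed.

(** * Complex-valued functions *)

Section ComplexExpansion.
Context (R : rcfType).

(** The power of the imaginary unit that accompanies the choice of imaginary
    parts at the indices in [J]. *)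
Definition imag_phase (k : nat) (J : {set 'I_k}) : R[i] :=
  \prod_(i < k) (if i \in J then 'i%C else 1).

Lemma normc_imag_phase k (J : {set 'I_k}) : Normc.normc (imag_phase J) = 1.
Proof.
apply: (big_ind (fun z => Normc.normc z = 1)) => [|x y hx hy|i _].
- exact: Normc.normc1.
- by rewrite Normc.normcM hx hy mulr1.
- case: ifP => _; last exact: Normc.normc1.
  by rewrite /Normc.normc /= expr0n expr1n add0r sqrtr1.
Qed.

Lemma normc_sum_le I (s : seq I) (F : I -> R[i]) :
  Normc.normc (\sum_(i <- s) F i) <= \sum_(i <- s) Normc.normc (F i).
Proof.
apply: (big_ind2 (fun (z : R[i]) (r : R) => Normc.normc z <= r)) => //.
- by rewrite Normc.normc0.
- by move=> z r z' r' h h'; rewrite (le_trans (le_normcD _ _))// lerD.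
Qed.

Lemma normc_real (r : R) : Normc.normc (r%:C)%C = `|r|.
Proof. by rewrite /Normc.normc /= expr0n addr0 sqrtr_sqr. Qed.

Lemma sqr_normc_ReIm (z : R[i]) :
  Normc.normc z ^+ 2 = complex.Re z ^+ 2 + complex.Im z ^+ 2.
Proof. by case: z => a b /=; rewrite sqr_sqrtr// addr_ge0// sqr_ge0. Qed.

Lemma prod_complex k (z : 'I_k -> R[i]) :
  \prod_(i < k) z i = \sum_(J : {set 'I_k}) imag_phase J *
    ((\prod_(i < k) (if i \in J then complex.Im (z i) else complex.Re (z i)))%:C)%C.
Proof.
under eq_bigr do rewrite [z _]complexE addrC.
rewrite bigA_distr; apply: eq_bigr => J _.
rewrite rmorph_prod -big_split; apply: eq_bigr => i _ /=.
by case: ifP => //; rewrite mul1r.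
Qed.

End ComplexExpansion.

Section ComplexMeasurable.
Context d (X : measurableType d) (R : realType).
Implicit Types f g : X -> R[i].

Definition complex_measurable f : Prop :=
  measurable_fun setT (fun x => complex.Re (f x)) /\
  measurable_fun setT (fun x => complex.Im (f x)).

Lemma complex_measurable_cst (z : R[i]) : complex_measurable (fun=> z).
Proof. by split; exact: measurable_cst. Qed.

Lemma complex_measurableD f g : complex_measurable f -> complex_measurable g ->
  complex_measurable (fun x => f x + g x).
Proof.
move=> [fr fi] [gr gi]; split.
- rewrite (_ : (fun x => _) = (fun x => complex.Re (f x) + complex.Re (g x))).
    exact: measurable_funD.
  by apply/funext => x; case: (f x) (g x) => ? ? [].
- rewrite (_ : (fun x => _) = (fun x => complex.Im (f x) + complex.Im (g x))).
    exact: measurable_funD.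
  by apply/funext => x; case: (f x) (g x) => ? ? [].
Qed.

Lemma complex_measurableM f g : complex_measurable f -> complex_measurable g ->
  complex_measurable (fun x => f x * g x).
Proof.
move=> [fr fi] [gr gi]; split.
- rewrite (_ : (fun x => _) = (fun x => complex.Re (f x) * complex.Re (g x) -
      complex.Im (f x) * complex.Im (g x))).
    by apply: measurable_funB; exact: measurable_funM.
  by apply/funext => x; case: (f x) (g x) => ? ? [].
- rewrite (_ : (fun x => _) = (fun x => complex.Re (f x) * complex.Im (g x) +
      complex.Im (f x) * complex.Re (g x))).
    by apply: measurable_funD; exact: measurable_funM.
  by apply/funext => x; case: (f x) (g x) => ? ? [].
Qed.

Lemma complex_measurable_sum I (s : seq I) (F : I -> X -> R[i]) :
  (forall i, complex_measurable (F i)) ->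
  complex_measurable (fun x => \sum_(i <- s) F i x).
Proof.
move=> mF; elim: s => [|i s ih].
  under eq_fun do rewrite big_nil; exact: complex_measurable_cst.
under eq_fun do rewrite big_cons; exact: complex_measurableD.
Qed.

Lemma complex_measurable_prod I (s : seq I) (F : I -> X -> R[i]) :
  (forall i, complex_measurable (F i)) ->
  complex_measurable (fun x => \prod_(i <- s) F i x).
Proof.
move=> mF; elim: s => [|i s ih].
  under eq_fun do rewrite big_nil; exact: complex_measurable_cst.
under eq_fun do rewrite big_cons; exact: complex_measurableM.
Qed.

Lemma complex_measurable_comp f (S : X -> X) : measurable_fun setT S ->
  complex_measurable f -> complex_measurable (fun x => f (S x)).
Proof.
move=> mS [fr fi]; split.
- exact: (measurableT_comp (f := fun x => complex.Re (f x))).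
- exact: (measurableT_comp (f := fun x => complex.Im (f x))).
Qed.

Variable P : probability X R.

Lemma Lnorm2_complex f : Lnorm P 2%:E (fun x => (Normc.normc (f x))%:E) =
  ((\int[P]_x (complex.Re (f x) ^+ 2 + complex.Im (f x) ^+ 2)%:E) `^ 2^-1)%E.
Proof.
rewrite unlock /Lnorm; congr (_ `^ _)%E; apply: eq_integral => x _.
rewrite abse_EFin poweR_EFin powR_mulrn ?normr_ge0//; congr EFin.
by rewrite real_normK ?num_real// sqr_normc_ReIm.
Qed.

(** Bounding the squared modulus almost everywhere lets [z] be built from
    essentially bounded functions while [S] is built from their truncations. *)
Lemma cvg_Lnorm2_of_bound (z : nat -> X -> R[i]) (S : nat -> X -> R) :
  (forall N, complex_measurable (z N)) -> (forall N, bounded_measurable (S N)) ->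
  (forall N x, 0 <= S N x) ->
  (forall N, {ae P, forall x,
    complex.Re (z N x) ^+ 2 + complex.Im (z N x) ^+ 2 <= S N x}) ->
  \int[P]_x S N x @[N --> \oo] --> (0 : R) ->
  Lnorm P 2%:E (fun x => (Normc.normc (z N x))%:E) @[N --> \oo] --> 0%E.
Proof.
move=> mz bS Sge0 zS S0.
have up N : (Lnorm P 2%:E (fun x => (Normc.normc (z N x))%:E) <=
             (Num.sqrt (\int[P]_x S N x))%:E)%E.
  rewrite Lnorm2_complex.
  have intS := bounded_measurable_integrable P (bS N).
  have le : (\int[P]_x (complex.Re (z N x) ^+ 2 + complex.Im (z N x) ^+ 2)%:E <=
             (\int[P]_x S N x)%:E)%E.
    rewrite /Rintegral fineK; last exact: integrable_fin_num intS.
    have [mr mi] := mz N; have [mS _] := bS N.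
    apply: ae_ge0_le_integral => //.
    - by move=> x _; rewrite lee_fin addr_ge0// sqr_ge0.
    - by apply/measurable_EFinP/measurable_funD; exact: measurable_funX.
    - by move=> x _; rewrite lee_fin.
    - exact/measurable_EFinP.
    - by apply: filterS (zS N) => x h _; rewrite lee_fin.
  have q0 : 0 <= \int[P]_x S N x by exact: Rintegral_ge0.
  rewrite -powR12_sqrt// -poweR_EFin; apply: gt0_ler_poweR => //.
  - rewrite in_itv/= leey andbT; apply: integral_ge0 => x _.
    by rewrite lee_fin addr_ge0 ?sqr_ge0.
  - by rewrite in_itv/= leey andbT lee_fin.
apply: (@squeeze_cvge _ _ _ _ (cst 0%E) _
  (fun N => (Num.sqrt (\int[P]_x S N x))%:E)).
- by apply: nearW => N; rewrite Lnorm_ge0/= up.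
- exact: cvg_cst.
- apply: cvg_EFin; first exact: nearW.
  apply/cvg0_near => e e0; have e20 : 0 < e ^+ 2 by rewrite exprn_gt0.
  move/cvg0_near : S0 => /(_ _ e20); apply: filterS => N hN /=.
  rewrite ger0_norm ?sqrtr_ge0// -(ger0_norm (ltW e0)) -sqrtr_sqr.
  by rewrite ler_wsqrtr// (le_trans (ler_norm _)).
Qed.

End ComplexMeasurable.

(** * Convergence in the quadratic mean *)

Section QuadraticMean.
Context d (X : measurableType d) (R : realType) (P : probability X R).

Lemma ae_measure_preserving (S : X -> X) (A : X -> Prop) :
  measure_preserving P S -> {ae P, forall x, A x} -> {ae P, forall x, A (S x)}.
Proof.
move=> [mS pS] [N [mN N0 AN]]; exists (S @^-1` N); split.
- by rewrite -[X in measurable X]setTI; exact: mS.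
- by rewrite -N0; exact: pS.
- by move=> x; exact: AN.
Qed.

Definition clip (M y : R) : R := Num.max (- M) (Num.min y M).

Lemma clip_bound M y : 0 <= M -> `|clip M y| <= M.
Proof.
move=> M0; rewrite ler_norml /clip le_max lexx /= ge_max ge_min lexx orbT andbT.
by rewrite (le_trans _ M0)// oppr_le0.
Qed.

Lemma clip_id M y : `|y| <= M -> clip M y = y.
Proof.
rewrite ler_norml /clip => /andP[h1 h2].
by rewrite min_l// max_r.
Qed.

Lemma measurable_clip M (f : X -> R) : measurable_fun setT f ->
  measurable_fun setT (fun x => clip M (f x)).
Proof.
move=> mf; apply: measurable_maxr; first exact: measurable_cst.
by apply: measurable_minr => //; exact: measurable_cst.
Qed.

(** The essential supremum bounds the real and imaginary parts almost everywhere,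
    so clipping them there changes them on a null set only. *)
Lemma Linfty_bounded_version (f : X -> R[i]) : Linfty_complex P f ->
  exists g : X -> R[i], [/\ bounded_measurable (fun x => complex.Re (g x)),
    bounded_measurable (fun x => complex.Im (g x)) & {ae P, forall x, f x = g x}].
Proof.
move=> [mr mi]; rewrite unlock /Lnorm; case: ifPn => [_ sup|/negP]; last first.
  move=> h _; exfalso; apply: h.
  by apply: (lt_le_trans (@lte01 R)); rewrite le_eqVlt; apply/orP; left;
    apply/eqP; exact: esym (probability_setT P).
have [M M0 hM] : exists2 M : R, 0 <= M &
    {ae P, forall x, Normc.normc (f x) <= M}.
  have := ess_sup_ge P (abse \o (fun x => (Normc.normc (f x))%:E)).
  move: sup; set s := ess_sup _ _ => sup h.
  exists `|fine s| => //; apply: filterS h => x /=.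
  move: sup; case: s => [s _|//|_].
    rewrite lee_fin => h.
    by rewrite (le_trans (ler_norm _))// (le_trans h)// ler_norm.
  by rewrite leeNy_eq.
exists (fun x => Complex (clip M (complex.Re (f x))) (clip M (complex.Im (f x)))).
split.
- split; first exact: measurable_clip.
  by exists M => x; exact: clip_bound.
- split; first exact: measurable_clip.
  by exists M => x; exact: clip_bound.
- apply: filterS hM => x h.
  have le2 : complex.Re (f x) ^+ 2 <= M ^+ 2 /\ complex.Im (f x) ^+ 2 <= M ^+ 2.
    have : Normc.normc (f x) ^+ 2 <= M ^+ 2.
      rewrite ler_pXn2r// ?nnegrE//.
      by case: (f x) => a b; exact: sqrtr_ge0.
    rewrite sqr_normc_ReIm => h2.
    have := sqr_ge0 (complex.Re (f x)); have := sqr_ge0 (complex.Im (f x)).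
    by split; lra.
  by rewrite !clip_id ?norm_le_of_sqr//; [case: (f x)|case: le2|case: le2].
Qed.

Lemma eq_integral_complex_ae (f g : X -> R[i]) : complex_measurable f ->
  complex_measurable g -> {ae P, forall x, f x = g x} ->
  integral_complex P f = integral_complex P g.
Proof.
move=> [fr fi] [gr gi] fg; rewrite /integral_complex /Rintegral.
congr (Complex (fine _) (fine _)); apply: ae_eq_integral => //;
  try exact/measurable_EFinP.
- by apply: filterS fg => x -> _.
- by apply: filterS fg => x -> _.
Qed.

Variables (T Tinv : X -> X).
Hypothesis hT : invertible_measure_preserving P T Tinv.
Hypothesis wmT : weakly_mixing P T.
Local Notation tau := (iterz T Tinv).

Section NearLinear.
Variables (k : nat) (phi : 'I_k -> int -> int) (alpha : 'I_k -> R) (C : 'I_k -> R).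
Hypothesis phi_near : forall i n, `|(phi i n)%:~R - alpha i * n%:~R| <= C i.
Hypothesis alpha_inj : injective alpha.
Hypothesis alpha_neq0 : forall i, alpha i != 0.

Definition deviation (f : 'I_k -> X -> R) (N : nat) (x : X) : R :=
  N%:R^-1 * (\sum_(1 <= n < N.+1) \prod_(i < k) f i (tau (phi i n%:Z) x)) -
  \prod_(i < k) \int[P]_x f i x.

Lemma deviation_cvg0 (f : 'I_k -> X -> R) : (forall i, bounded_measurable (f i)) ->
  \int[P]_x `|deviation f N x| @[N --> \oo] --> (0 : R).
Proof.
move=> bf.
pose fac i := Factor (alpha i) (fun n => phi i n.+1%:Z) (fun=> f i).
pose l := [seq fac i | i <- enum 'I_k].
have gl : good_factors l.
  rewrite /l; elim: (enum 'I_k) => //= i s ih; split => //; split; last first.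
    exact: finitely_coloured_cst.
  exists (Num.truncn (C i + `|alpha i|)).+1 => n /=.
  rewrite (le_trans _ (ltW (truncnS_gt _)))//.
  have -> : (phi i n.+1%:Z)%:~R - alpha i * n%:R =
    ((phi i n.+1%:Z)%:~R - alpha i * (n.+1%:Z)%:~R) + alpha i.
    by rewrite -pmulrn -natr1; ring.
  by rewrite (le_trans (ler_normD _ _))// lerD.
have ul : uniq (0 :: map (@slope _ _ _) l).
  rewrite /l -map_comp /= (map_inj_uniq alpha_inj) enum_uniq andbT.
  by apply/mapP => -[i _ /esym/eqP]; rewrite (negbTE (alpha_neq0 i)).
have joint_prodE n x : joint_prod T Tinv l n x =
    \prod_(i < k) f i (tau (phi i n.+1%:Z) x).
  by rewrite /joint_prod /l big_map big_enum.
have mean_prodE n : mean_prod_factors P l n = \prod_(i < k) \int[P]_x f i x.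
  by rewrite /mean_prod_factors /l big_map big_enum.
have b1 : bounded_seq (fun=> 1 : R) by exists 1 => n; rewrite normr1.
have := jointly_mixing_of_slopes hT wmT gl ul b1; apply: cvg_trans.
apply: near_eq_cvg; near=> N.
have N0 : (0 < N)%N by near: N; exact: nbhs_infty_gt.
apply: eq_Rintegral => x _; congr `|_|.
rewrite /deviation /avg big_add1 /= big_mkord.
under eq_bigr do rewrite mul1r joint_prodE mean_prodE.
rewrite sumrB sumr_const card_ord mulrBr -[X in _ - _ * X]mulr_natl mulKf//.
by rewrite pnatr_eq0 -lt0n.
Unshelve. all: by end_near. Qed.

Lemma bounded_measurable_deviation (f : 'I_k -> X -> R) N :
  (forall i, bounded_measurable (f i)) -> bounded_measurable (deviation f N).
Proof.
move=> bf; apply: bounded_measurableB; last exact: bounded_measurable_cst.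
apply: bounded_measurableZ; apply: bounded_measurable_sum => n.
apply: bounded_measurable_prod => i.
apply: (bounded_measurable_comp (S := tau (phi i n%:Z))) => //.
by have [] := measure_preserving_iterz hT (phi i n%:Z).
Qed.

Lemma deviation_bounded (f : 'I_k -> X -> R) : (forall i, bounded_measurable (f i)) ->
  exists B : R, forall N x, `|deviation f N x| <= B.
Proof.
move=> bf; have [M M0 hM] := finite_bounded bf.
exists (M ^+ k + M ^+ k) => N x.
have prodM (u : 'I_k -> R) : (forall i, `|u i| <= M) ->
    `|\prod_(i < k) u i| <= M ^+ k.
  move=> uM; rewrite normr_prod -[in leRHS](card_ord k) -prodr_const.
  by apply: ler_prod => i _; rewrite normr_ge0 uM.
rewrite (le_trans (ler_normB _ _))// lerD//; last first.
  by apply: prodM => i; exact: norm_mean_le.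
rewrite big_add1 big_mkord.
apply: (@norm_avg_bound _ N
  (fun n => \prod_(i < k) f i (tau (phi i n.+1%:Z) x))) => n.
by apply: prodM.
Qed.

Definition part (g : 'I_k -> X -> R[i]) (J : {set 'I_k}) (i : 'I_k) (x : X) : R :=
  if i \in J then complex.Im (g i x) else complex.Re (g i x).

Lemma ergodic_average_expand (g : 'I_k -> X -> R[i]) N x :
  ergodic_average T Tinv phi g N x - \prod_(i < k) integral_complex P (g i) =
  \sum_(J : {set 'I_k}) imag_phase R J * ((deviation (part g J) N x)%:C)%C.
Proof.
rewrite /ergodic_average prod_complex.
under [X in _ * X - _]eq_bigr do rewrite prod_complex.
rewrite exchange_big mulr_sumr -sumrB; apply: eq_bigr => J _.
rewrite -mulr_sumr mulrCA -mulrBr /deviation rmorphB rmorphM fmorphV rmorph_nat.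
rewrite rmorph_sum; congr (_ * (_ - _)).
congr ((_)%:C)%C; apply: eq_bigr => i _.
by rewrite /part; case: ifP.
Qed.

(** The error is dominated by the sum [s] of the real errors of all choices of
    real and imaginary parts; as [s] is bounded by a constant [b], its square is
    at most [b * s], whose mean tends to zero. *)
Lemma near_linear_cvg_L2 (f : 'I_k -> X -> R[i]) :
  (forall i, Linfty_complex P (f i)) ->
  cvg_L2_complex P (ergodic_average T Tinv phi f)
    (fun=> \prod_(i < k) integral_complex P (f i)).
Proof.
move=> Lf.
have /choice[g hg] : forall i, exists g : X -> R[i],
    [/\ bounded_measurable (fun x => complex.Re (g x)),
    bounded_measurable (fun x => complex.Im (g x)) & {ae P, forall x, f i x = g x}].
  by move=> i; exact: Linfty_bounded_version.
have cf i : complex_measurable (f i) by have [] := Lf i.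
have cg i : complex_measurable (g i) by have [[? _] [? _] _] := hg i.
have bpart J i : bounded_measurable (part g J i).
  by have [? ? _] := hg i; rewrite /part; case: (i \in J).
have mtau m : measurable_fun setT (tau m).
  by have [] := measure_preserving_iterz hT m.
have intE : \prod_(i < k) integral_complex P (f i) =
    \prod_(i < k) integral_complex P (g i).
  apply: eq_bigr => i _; apply: eq_integral_complex_ae => //.
  by have [] := hg i.
have /choice[B hB] : forall J, exists B : R,
    forall N x, `|deviation (part g J) N x| <= B.
  by move=> J; exact: deviation_bounded.
pose s N x := \sum_(J : {set 'I_k}) `|deviation (part g J) N x|.
have s0 N x : 0 <= s N x by exact: sumr_ge0.
pose b := \sum_(J : {set 'I_k}) B J.
have sb N x : s N x <= b by apply: ler_sum => J _; exact: hB.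
have bs N : bounded_measurable (s N).
  apply: bounded_measurable_sum => J; apply: bounded_measurable_norm.
  exact: bounded_measurable_deviation.
have ae_eq_orbit : {ae P, forall x, forall (n : nat) (i : 'I_k),
    f i (tau (phi i n%:Z) x) = g i (tau (phi i n%:Z) x)}.
  apply: ae_foralln => n; apply: filter_forall => i.
  have [_ _ fg] := hg i.
  exact: (ae_measure_preserving (measure_preserving_iterz hT (phi i n%:Z)) fg).
apply: (@cvg_Lnorm2_of_bound _ _ _ _ _ (fun N x => b * s N x)).
- move=> N; apply: complex_measurableD; last exact: complex_measurable_cst.
  apply: complex_measurableM; first exact: complex_measurable_cst.
  apply: complex_measurable_sum => n; apply: complex_measurable_prod => i.
  exact: complex_measurable_comp.
- by move=> N; exact: bounded_measurableZ.
- by move=> N x; rewrite mulr_ge0// (le_trans (s0 N x)).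
- move=> N; apply: filterS ae_eq_orbit => x fgx.
  have -> : ergodic_average T Tinv phi f N x = ergodic_average T Tinv phi g N x.
    congr (_ * _); apply: eq_bigr => n _; apply: eq_bigr => i _; exact: fgx.
  rewrite intE ergodic_average_expand -sqr_normc_ReIm.
  set z := \sum_(J : {set 'I_k}) _.
  have zs : Normc.normc z <= s N x.
    rewrite (le_trans (normc_sum_le _ _))//; apply: ler_sum => J _.
    by rewrite Normc.normcM normc_imag_phase mul1r normc_real.
  have z0 : 0 <= Normc.normc z by case: (z) => ? ?; exact: sqrtr_ge0.
  rewrite expr2; apply: ler_pM => //; exact: (le_trans zs).
- have sE N : \int[P]_x (b * s N x) =
      b * \sum_(J : {set 'I_k}) \int[P]_x `|deviation (part g J) N x|.
    rewrite meanZ// /s mean_sum// => J.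
    by apply: bounded_measurable_norm; exact: bounded_measurable_deviation.
  rewrite (eq_cvg _ _ sE); apply: cvg0Z.
  by apply: cvg0_sum => J; exact: deviation_cvg0.
Qed.

End NearLinear.
End QuadraticMean.

Theorem corollary0p5 (R : realType) (d : measure_display)
    (X : measurableType d) (P : probability X R) (T Tinv : X -> X)
    (hT : invertible_measure_preserving P T Tinv)
    (hwm : weakly_mixing P T) :
  (forall (k : nat) (phi : 'I_k -> int -> int),
     (forall i, gen_linear_int R (phi i)) ->
     (forall i, unbounded_int (phi i)) ->
     (forall i j, i != j -> unbounded_int (fun n => phi j n - phi i n)) ->
     forall f : 'I_k -> X -> R[i],
       (forall i, Linfty_complex P (f i)) ->
       cvg_L2_complex P (ergodic_average T Tinv phi f)
         (fun=> \prod_(i < k) integral_complex P (f i)))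
  /\
  (forall (k : nat) (alpha : 'I_k -> R),
     injective alpha ->
     (forall i, alpha i != 0) ->
     forall f : 'I_k -> X -> R[i],
       (forall i, Linfty_complex P (f i)) ->
       cvg_L2_complex P
         (ergodic_average T Tinv
            (fun i n => Num.floor (alpha i * n%:~R)) f)
         (fun=> \prod_(i < k) integral_complex P (f i))).
Proof.
split=> [k phi gphi unb unbD f Lf|k alpha alpha_inj alpha0 f Lf]; last first.
  by apply: (@near_linear_cvg_L2 _ _ _ _ _ _ hT hwm k _ alpha (fun=> 1)) => // i n;
    exact: floor_dist.
have /choice[a /choice[C hC]] : forall i, exists a C : R,
    forall n, `|(phi i n)%:~R - a * n%:~R| <= C.
  move=> i; have [g /gen_linear_near_linear[a [C hC]] phiE] := gphi i.
  by exists a, C => n; rewrite phiE.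
apply: (near_linear_cvg_L2 hT hwm hC) => //.
- move=> i j aij; apply/eqP/negP => /negP ij.
  (* Equal slopes would make the difference a bounded function. *)
  have := @unbounded_slope R _ (a j - a i) (C j + C i) (unbD i j ij).
  rewrite aij subrr eqxx => h; suff: false by []. apply: h => n.
  rewrite intrB mul0r subr0.
  have -> : (phi j n)%:~R - (phi i n)%:~R =
    ((phi j n)%:~R - a j * n%:~R) - ((phi i n)%:~R - a i * n%:~R).
    by rewrite aij; ring.
  by rewrite (le_trans (ler_normB _ _))// lerD.
- by move=> i; exact: unbounded_slope (unb i) (hC i).
Qed.
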